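(* Assume the setting in the context, and suppose Assumption (A) of the context holds for some $r>1$ and $\delta\in(0,\frac14]$. Put $\tilde k=36\,r\,c\,k_0(1+\gamma)\gamma_{\rm inc}$ and $\kappa=\rho_+(A,2\tilde k)/\rho_-(A,2\tilde k)$. Let $x^{(t)}$ denote the $t$-th iterate of $\mathrm{ProxGrad}_{\phi_\lambda}(x^{(0)},L_0,L_{\min},\epsilon')$, the proximal-gradient method with backtracking described in the context, and let $x^*\in\operatorname{argmin}_x\phi_\lambda(x)$. Suppose $L_{\min}\le\gamma_{\rm inc}\,\rho_+(A,2\tilde k)$ and $\lambda\ge\lambda_{\rm tgt}$. If $x^{(0)}$ satisfies $$K(x^{(0)})\le\tilde k,\qquad\omega_\lambda(x^{(0)})\le\delta\lambda,$$ then for all iterates $t\ge0$ $$K(x^{(t)})\le\tilde k,$$ $$\phi_\lambda(x^{(t)})-\phi_\lambda(x^* )\le\left(1-\frac{1}{4\gamma_{\rm inc}\kappa}\right)^t\left(\phi_\lambda(x^{(0)})-\phi_\lambda(x^* )\right),$$ and for all $t\ge1$ $$\omega_\lambda(x^{(t)})\le\left(1+\frac{\sqrt{\rho_+(A,1)\,\rho_+(A,2\tilde k)}}{\rho_-(A,2\tilde k)}\right)\sqrt{2\gamma_{\rm inc}\,\rho_+(A,2\tilde k)\left(\phi_\lambda(x^{(t-1)})-\phi_\lambda(x^* )\right)}.$$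
   Context: Setting. $\mathbb{R}^n$ is equipped with the inner product $\langle x,y\rangle=x^TBy$ ($B$ symmetric positive definite), $\mathbb{R}^m$ with the standard dot product; $\|\cdot\|_2$ denotes the induced norm in each, and $\perp$ refers to these inner products. $\|\cdot\|$ is a norm on $\mathbb{R}^n$ with dual norm $\|y\|^*=\sup\{\langle y,x\rangle:\|x\|\le1\}$ and subdifferential $\partial\|x\|$ (with respect to $\langle\cdot,\cdot\rangle$). It is assumed that (i) every extreme point $a$ of $\{x:\|x\|\le1\}$ has $\|a\|_2=1$, and (ii) (decomposability) for every $x\in\mathbb{R}^n$ there are a subspace $T_x$ and a vector $e_x\in T_x$ with $\partial\|x\|=\{e_x+v: v\in T_x^\perp,\ \|v\|^*\le1\}$. Put $K(x)=\|e_x\|_2^2$. Let $A\in\mathbb{R}^{m\times n}$ with adjoint $A^*=B^{-1}A^T$, and $b=Ax_0+z$ with $x_0\in\mathbb{R}^n\setminus\{0\}$, $z\in\mathbb{R}^m$. Put $f(x)=\frac12\|Ax-b\|_2^2$ (so $\nabla f(x)=A^*(Ax-b)$), $\phi_\lambda(x)=f(x)+\lambda\|x\|$, and $\omega_\lambda(x)=\min_{\xi\in\partial\|x\|}\|\lambda\xi+\nabla f(x)\|^*$. Put $k_0=K(x_0)$ and $c=\max_{x\in T_{x_0}\setminus\{0\}}\frac{\|x\|^2}{k_0\|x\|_2^2}$. $\rho_+(A,k)$ (resp. $\rho_-(A,k)$) is the smallest (resp. largest) nonnegative constant such that $\rho_-(A,k)\|x\|_2^2\le\|Ax\|_2^2\le\rho_+(A,k)\|x\|_2^2$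 for all $x$ with $\|x\|^2\le k\|x\|_2^2$. Let $\gamma_{\rm inc}>1$, $\gamma_{\rm dec}\ge1$, $\lambda_{\rm tgt}>0$, $L_{\min}>0$ be parameters. Assumption (A) for $r>1$, $\delta\in(0,\frac14]$: $\|A^*z\|^*\le\lambda_{\rm tgt}/4$, and with $\gamma=\frac{\lambda_{\rm tgt}(1+\delta)+\|A^*z\|^*}{\lambda_{\rm tgt}(1-\delta)-\|A^*z\|^*}$, $$\frac{\rho_-(A,ck_0(1+\gamma)^2)}{\rho_+(A,72rck_0(1+\gamma)\gamma_{\rm inc})}>\frac cr,\qquad \rho_-(A,72rck_0(1+\gamma)\gamma_{\rm inc})>0.$$ Proximal-gradient method $\mathrm{ProxGrad}_{\phi_\lambda}(x^{(0)},L_0,L_{\min},\epsilon')$. Let $m_{\lambda,L}(y,x)=f(y)+\langle\nabla f(y),x-y\rangle+\frac L2\|x-y\|_2^2+\lambda\|x\|$ and $\mathrm{Prox}_{\lambda,L}(y)=\operatorname{argmin}_x m_{\lambda,L}(y,x)$. Given $x^{(t)}$ and $L_t$ (starting from the inputs $x^{(0)}$, $L_0$): start with $L=L_t$, and while $\phi_\lambda(\mathrm{Prox}_{\lambda,L}(x^{(t)}))>m_{\lambda,L}(x^{(t)},\mathrm{Prox}_{\lambda,L}(x^{(t)}))$ replace $L$ by $\gamma_{\rm inc}L$; then set $M_{t+1}=L$, $x^{(t+1)}=\mathrm{Prox}_{\lambda,M_{t+1}}(x^{(t)})$, $L_{t+1}=\max\{L_{\min},M_{t+1}/\gamma_{\rm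 dec}\}$. The method stops at the first $t\ge 1$ for which $\|M_t(x^{(t-1)}-x^{(t)})+\nabla f(x^{(t)})-\nabla f(x^{(t-1)})\|^*\le\epsilon'$.
   Formalization: The formal theorem additionally assumes 0 < L_0 ≤ γ_inc ρ_+(A,2k̃) for the initial step parameter; without it the first prox step is ill-defined (L_0 ≤ 0) or the stated linear rate fails (L_0 very large). *)

(* Defs.v *)
From HB Require Import structures.
From mathcomp Require Import all_boot all_order all_algebra.
From mathcomp Require Import all_classical all_reals.

Set Implicit Arguments.
Unset Strict Implicit.
Unset Printing Implicit Defensive.
Import Order.TTheory GRing.Theory Num.Theory.
Local Open Scope classical_set_scope.
Local Open Scope ring_scope.

Definition inner (R : realType) (n : nat) (B : 'M[R]_n) (x y : 'cV[R]_n) : R :=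
  (x^T *m B *m y) 0 0.

Definition sym_posdef (R : realType) (n : nat) (B : 'M[R]_n) : Prop :=
  B^T = B /\ forall x : 'cV[R]_n, x != 0 -> 0 < inner B x x.

Definition norm2 (R : realType) (n : nat) (B : 'M[R]_n) (x : 'cV[R]_n) : R :=
  Num.sqrt (inner B x x).

Definition enorm (R : realType) (m : nat) (y : 'cV[R]_m) : R := norm2 1%:M y.

Definition is_norm (R : realType) (n : nat) (N : 'cV[R]_n -> R) : Prop :=
  [/\ forall x, 0 <= N x,
      forall x, N x = 0 -> x = 0,
      forall (t : R) x, N (t *: x) = `|t| * N x
    & forall x y, N (x + y) <= N x + N y].

Definition dual_norm (R : realType) (n : nat) (B : 'M[R]_n)
    (N : 'cV[R]_n -> R) (y : 'cV[R]_n) : R :=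
  sup [set inner B y x | x in [set x | N x <= 1]].

Definition subdiff (R : realType) (n : nat) (B : 'M[R]_n)
    (N : 'cV[R]_n -> R) (x : 'cV[R]_n) : set 'cV[R]_n :=
  [set g | forall y, N x + inner B g (y - x) <= N y].

Definition extreme_point (R : realType) (n : nat) (S : set 'cV[R]_n)
    (a : 'cV[R]_n) : Prop :=
  S a /\ forall (x y : 'cV[R]_n) (t : R), S x -> S y -> 0 < t < 1 ->
    a = t *: x + (1 - t) *: y -> x = a /\ y = a.

Definition orth (R : realType) (n : nat) (B : 'M[R]_n)
    (V : {vspace 'cV[R]_n}) : set 'cV[R]_n :=
  [set v | forall u, u \in V -> inner B u v = 0].

(* T and e are determined by N: e x is the centre of the subdifferential at x,
   and the orthogonal complement of T x is the span of its translate by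
   - e x. *)
Definition decomposable (R : realType) (n : nat) (B : 'M[R]_n)
    (N : 'cV[R]_n -> R) (T : 'cV[R]_n -> {vspace 'cV[R]_n})
    (e : 'cV[R]_n -> 'cV[R]_n) : Prop :=
  forall x, e x \in T x /\
    subdiff B N x =
      [set e x + v | v in [set v | orth B (T x) v /\ dual_norm B N v <= 1]].

Definition Kof (R : realType) (n : nat) (B : 'M[R]_n)
    (e : 'cV[R]_n -> 'cV[R]_n) (x : 'cV[R]_n) : R := norm2 B (e x) ^+ 2.

Definition adj (R : realType) (m n : nat) (B : 'M[R]_n) (A : 'M[R]_(m, n)) :
  'M[R]_(n, m) := invmx B *m A^T.

Definition fls (R : realType) (m n : nat) (A : 'M[R]_(m, n)) (b : 'cV[R]_m)
    (x : 'cV[R]_n) : R := 2^-1 * enorm (A *m x - b) ^+ 2.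

(* The gradient of fls A b with respect to inner B. *)
Definition grad (R : realType) (m n : nat) (B : 'M[R]_n) (A : 'M[R]_(m, n))
    (b : 'cV[R]_m) (x : 'cV[R]_n) : 'cV[R]_n := adj B A *m (A *m x - b).

Definition phi (R : realType) (m n : nat) (N : 'cV[R]_n -> R)
    (A : 'M[R]_(m, n)) (b : 'cV[R]_m) (lam : R) (x : 'cV[R]_n) : R :=
  fls A b x + lam * N x.

(* The infimum is a minimum: subdiff B N x is nonempty and compact. *)
Definition omega (R : realType) (m n : nat) (B : 'M[R]_n) (N : 'cV[R]_n -> R)
    (A : 'M[R]_(m, n)) (b : 'cV[R]_m) (lam : R) (x : 'cV[R]_n) : R :=
  inf [set dual_norm B N (lam *: xi + grad B A b x) | xi in subdiff B N x].

(* For k >= 1 (and n > 0) the extremum in each of rho_plus and rho_minus is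
   attained when the extreme points of the unit ball of N have norm2 B equal
   to 1. Then norm2 B <= N, so for k < 1 only x = 0 satisfies the constraint,
   every constant is admissible, and no largest one exists. *)
Definition rho_plus (R : realType) (m n : nat) (B : 'M[R]_n)
    (N : 'cV[R]_n -> R) (A : 'M[R]_(m, n)) (k : R) : R :=
  inf [set s : R | 0 <= s /\ forall x : 'cV[R]_n,
    N x ^+ 2 <= k * norm2 B x ^+ 2 ->
    enorm (A *m x) ^+ 2 <= s * norm2 B x ^+ 2].

Definition rho_minus (R : realType) (m n : nat) (B : 'M[R]_n)
    (N : 'cV[R]_n -> R) (A : 'M[R]_(m, n)) (k : R) : R :=
  sup [set s : R | 0 <= s /\ forall x : 'cV[R]_n,
    N x ^+ 2 <= k * norm2 B x ^+ 2 ->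
    s * norm2 B x ^+ 2 <= enorm (A *m x) ^+ 2].

(* The supremum is a maximum: the quotient is continuous and homogeneous of
   degree 0. *)
Definition cconst (R : realType) (n : nat) (B : 'M[R]_n) (N : 'cV[R]_n -> R)
    (V : {vspace 'cV[R]_n}) (k0 : R) : R :=
  sup [set N x ^+ 2 / (k0 * norm2 B x ^+ 2) | x in
    [set x | x \in V /\ x != 0]].

Definition gamma_of (R : realType) (m n : nat) (B : 'M[R]_n)
    (N : 'cV[R]_n -> R) (A : 'M[R]_(m, n)) (z : 'cV[R]_m) (ltgt delta : R) : R :=
  (ltgt * (1 + delta) + dual_norm B N (adj B A *m z)) /
  (ltgt * (1 - delta) - dual_norm B N (adj B A *m z)).

Definition assumptionA (R : realType) (m n : nat) (B : 'M[R]_n)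
    (N : 'cV[R]_n -> R) (A : 'M[R]_(m, n)) (z : 'cV[R]_m)
    (k0 c ginc ltgt r delta : R) : Prop :=
  let gamma := gamma_of B N A z ltgt delta in
  let k1 := c * k0 * (1 + gamma) ^+ 2 in
  let k2 := 72 * r * c * k0 * (1 + gamma) * ginc in
  [/\ dual_norm B N (adj B A *m z) <= ltgt / 4,
      c / r < rho_minus B N A k1 / rho_plus B N A k2
    & 0 < rho_minus B N A k2].

Definition argmin (R : realType) (n : nat) (g : 'cV[R]_n -> R) :
  set 'cV[R]_n := [set p | forall x, g p <= g x].

Definition mmodel (R : realType) (m n : nat) (B : 'M[R]_n) (N : 'cV[R]_n -> R)
    (A : 'M[R]_(m, n)) (b : 'cV[R]_m) (lam L : R) (y x : 'cV[R]_n) : R :=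
  fls A b y + inner B (grad B A b y) (x - y) + L / 2 * norm2 B (x - y) ^+ 2
  + lam * N x.

(* For 0 < L and 0 <= lam the model is strongly convex and the minimizer
   exists and is unique; the default 0 of xget is then never used. *)
Definition prox (R : realType) (m n : nat) (B : 'M[R]_n) (N : 'cV[R]_n -> R)
    (A : 'M[R]_(m, n)) (b : 'cV[R]_m) (lam L : R) (y : 'cV[R]_n) : 'cV[R]_n :=
  xget 0 (argmin (mmodel B N A b lam L y)).

Definition ls_fails (R : realType) (m n : nat) (B : 'M[R]_n)
    (N : 'cV[R]_n -> R) (A : 'M[R]_(m, n)) (b : 'cV[R]_m) (lam : R)
    (y : 'cV[R]_n) (L : R) : Prop :=
  mmodel B N A b lam L y (prox B N A b lam L y) <
  phi N A b lam (prox B N A b lam L y).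

(* The while loop started at L exits with the value M. *)
Definition backtrack (R : realType) (m n : nat) (B : 'M[R]_n)
    (N : 'cV[R]_n -> R) (A : 'M[R]_(m, n)) (b : 'cV[R]_m) (lam ginc : R)
    (y : 'cV[R]_n) (L M : R) : Prop :=
  exists j : nat,
    [/\ M = ginc ^+ j * L,
        ~ ls_fails B N A b lam y M
      & forall i : nat, (i < j)%N -> ls_fails B N A b lam y (ginc ^+ i * L)].

Definition stop_test (R : realType) (m n : nat) (B : 'M[R]_n)
    (N : 'cV[R]_n -> R) (A : 'M[R]_(m, n)) (b : 'cV[R]_m) (eps : R)
    (x : nat -> 'cV[R]_n) (M : nat -> R) (t : nat) : Prop :=
  dual_norm B N (M t *: (x t.-1 - x t) + grad B A b (x t) - grad B A b (x t.-1))
  <= eps.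

(* The t-th iterate is produced: no s with 1 <= s < t passes the stopping test
   (the first s that passes is itself the index of an iterate). *)
Definition reached (R : realType) (m n : nat) (B : 'M[R]_n)
    (N : 'cV[R]_n -> R) (A : 'M[R]_(m, n)) (b : 'cV[R]_m) (eps : R)
    (x : nat -> 'cV[R]_n) (M : nat -> R) (t : nat) : Prop :=
  forall s : nat, (0 < s < t)%N -> ~ stop_test B N A b eps x M s.

(* x, L, M record a run; their values at indices that are not reached (and
   M 0) are unconstrained. *)
Definition prox_grad_run (R : realType) (m n : nat) (B : 'M[R]_n)
    (N : 'cV[R]_n -> R) (A : 'M[R]_(m, n)) (b : 'cV[R]_m)
    (lam ginc gdec : R) (xinit : 'cV[R]_n) (L0 Lmin eps : R)
    (x : nat -> 'cV[R]_n) (L M : nat -> R) : Prop :=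
  [/\ x 0%N = xinit, L 0%N = L0
    & forall t : nat, reached B N A b eps x M t.+1 ->
      [/\ backtrack B N A b lam ginc (x t) (L t) (M t.+1),
          x t.+1 = prox B N A b lam (M t.+1) (x t)
        & L t.+1 = Num.max Lmin (M t.+1 / gdec)]].

(* Main.v *)
(* The descent argument is that of Xiao and Zhang for l1; it needs two facts on
   a decomposable norm whose atoms (extreme points of the ball) are unit
   vectors. First, e x is a sum of orthogonal atoms and x a positive combination
   of the same atoms (peel off an atom maximising <x, .>, repeatedly), so that
   Kof is a rank. Second, this rank is subadditive, whence N (x - y)^2 <=
   (K x + K y) |x - y|^2: if p atoms could have a combination positive on the
   whole face {y : N y <= 1, <s, y> = 1} exposed by s of rank > p, maximise the
   minimum of that combination over all choices of the p atoms; the atoms move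
   freely in first order along their tangent spaces, so stationarity gives a
   minimiser y such that each atom is an eigenvector of y, and an atom with
   positive eigenvalue belongs to the face; induct on p.
   With these facts the restricted constants apply to differences of iterates.
   From a point below the initial level, every prox point with
   L <= ginc * rho_plus, accepted by the line search or not, has rank at most
   kt; so the line search stops below ginc * rho_plus, and the usual linear rate
   of the proximal gradient method for strongly convex functions follows. *)
Require Import Defs.
From HB Require Import structures.
From mathcomp Require Import all_boot all_order all_algebra.
From mathcomp Require Import all_classical all_reals.
From mathcomp Require Import topology normedtype derive.
From mathcomp Require Import ring lra.
Import Order.TTheory GRing.Theory Num.Theory.
Import numFieldNormedType.Exports.
Local Open Scope classical_set_scope.
Local Open Scope ring_scope.
Set Implicit Arguments.
Unset Strict Implicit.
Unset Printing Implicit Defensive.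

(** Decomposability speaks only of subdifferentials; the orthogonality relations have to be
    extracted from it. The lever is that an atom a satisfies e a = a: the dual-ball vectors with
    value 1 at a are exactly the a + v with v in the dual ball and orthogonal to T a, and then a - v
    is in the dual ball too. Testing such pairs of opposite sign against one vector yields the
    relations. The descent faces a circularity: [rho_plus] controls the line search only between
    points of small rank, while the rank of a trial point is controlled only for L at most ginc *
    rho_plus. Hence the rank is bounded at every trial point, and the bound on L is carried along
    with the iterates, starting from L0. Ranks are measured in units of r k0 (1 + gamma) ginc: 20
    units make the optimality test fail, rounding up costs at most one more and k0 at most half of
    one; since c >= 1, the factor 36 c in kt covers this. *)

Section MatrixExtrema.
Variable R : realType.

(** * Compactness and attained minima for real matrices *)

Lemma ler_mx_norm (m n : nat) (x : 'M[R]_(m, n)) i j : `|x i j| <= `|x|.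
Proof.
rewrite [leRHS]/Num.norm /= mx_normrE; apply/bigmax_geP; right => /=.
by exists (i, j).
Qed.

Lemma mx_norm_le (m n : nat) (x : 'M[R]_(m, n)) (C : R) :
  0 <= C -> (forall i j, `|x i j| <= C) -> `|x| <= C.
Proof.
move=> C0 xC; rewrite [leLHS]/Num.norm /= mx_normrE.
by apply/bigmax_leP; split => // -[i j] _ /=.
Qed.

Lemma normr_vec_mx (m n : nat) (v : 'rV[R]_(m * n)) : `|vec_mx v| = `|v|.
Proof.
apply/le_anti/andP; split; apply: mx_norm_le => // i j.
  by rewrite mxE; exact: ler_mx_norm.
rewrite -[v]vec_mxK ord1; case/mxvec_indexP: j => k l.
rewrite mxvecE vec_mxK; exact: ler_mx_norm.
Qed.

Lemma vec_mx_continuous (m n : nat) :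
  continuous (@vec_mx R m n).
Proof.
move=> v A /nbhs_ballP[e /= e0 eA]; apply/nbhs_ballP; exists e => //= u /= vu.
apply: eA; move: vu; rewrite !mx_norm_ball /ball_ /= -linearB normr_vec_mx.
by [].
Qed.

(** [vec_mx] is an isometry for the max norm, so Heine-Borel for row vectors carries over: the set
    is the image of its preimage. *)
Lemma mx_closed_bounded_compact (m n : nat) (S : set 'M[R]_(m, n)) (C : R) :
  closed S -> (forall x, S x -> `|x| <= C) -> compact S.
Proof.
move=> cS bS.
have -> : S = vec_mx @` (vec_mx @^-1` S).
  apply/seteqP; split => [x Sx|_ [v Sv <-]] //.
  by exists (mxvec x); rewrite /= ?mxvecK.
apply: continuous_compact.
  by apply: continuous_subspaceT; exact: vec_mx_continuous.
apply: bounded_closed_compact.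
  exists C; split; first exact: num_real.
  move=> M CM v /= Sv; rewrite -normr_vec_mx.
  by apply: le_trans (ltW CM); exact: bS.
by apply: closed_comp => // v _; exact: vec_mx_continuous.
Qed.

Lemma mx_exists_min (m n : nat) (S : set 'M[R]_(m, n)) (f : 'M[R]_(m, n) -> R)
    (C : R) : continuous f -> closed S -> S !=set0 ->
  (forall x, S x -> `|x| <= C) ->
  exists2 x, S x & forall y, S y -> f x <= f y.
Proof.
move=> cf cS S0 bS.
have [] := compact_EVT_min S0 (mx_closed_bounded_compact cS bS)
  (continuous_subspaceT cf).
by move=> x /set_mem Sx fx; exists x => // y Sy; apply: fx; exact: mem_set.
Qed.

Lemma continuous_opp (T : topologicalType) (f : T -> R) :
  continuous f -> continuous (fun x => - f x).
Proof. by move=> cf x; apply: cvgN; exact: cf. Qed.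

Lemma continuous_add (T : topologicalType) (f g : T -> R) :
  continuous f -> continuous g -> continuous (fun x => f x + g x).
Proof. by move=> cf cg x; apply: cvgD; [exact: cf|exact: cg]. Qed.

Lemma continuous_mul (T : topologicalType) (f g : T -> R) :
  continuous f -> continuous g -> continuous (fun x => f x * g x).
Proof. by move=> cf cg x; apply: cvgM; [exact: cf|exact: cg]. Qed.

Lemma continuous_sum (T : topologicalType) (I : Type) (r : seq I) (F : I -> T -> R) :
  (forall i, continuous (F i)) -> continuous (fun x => \sum_(i <- r) F i x).
Proof.
move=> cF; elim: r => [|i r IH].
  by under eq_fun do rewrite big_nil; exact: cst_continuous.
by under eq_fun do rewrite big_cons; exact: continuous_add.
Qed.

Lemma closed_le_fun (T : topologicalType) (f g : T -> R) :
  continuous f -> continuous g -> closed [set x | f x <= g x].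
Proof.
move=> cf cg.
have -> : [set x | f x <= g x] = (fun x => g x - f x) @^-1` [set y : R | 0 <= y].
  by apply/seteqP; split => x /=; rewrite subr_ge0.
apply: closed_comp; last exact: closed_ge.
by move=> x _; apply: cvgB; [exact: cg|exact: cf].
Qed.

End MatrixExtrema.

(** * The inner product given by B *)

Section InnerProduct.
Variables (R : realType) (n : nat) (B : 'M[R]_n).
Hypothesis hB : sym_posdef B.
Local Notation ip := (inner B).
Implicit Types x y z u v : 'cV[R]_n.

Lemma innerC x y : ip x y = ip y x.
Proof.
by rewrite /inner -[in LHS](trmxK (_ *m _ *m _)) mxE !trmx_mul trmxK hB.1 mulmxA.
Qed.

Lemma innerDl x y z : ip (x + y) z = ip x z + ip y z.
Proof. by rewrite /inner linearD /= !mulmxDl mxE. Qed.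

Lemma innerZl a x y : ip (a *: x) y = a * ip x y.
Proof. by rewrite /inner linearZ /= -!scalemxAl mxE. Qed.

Lemma innerDr x y z : ip z (x + y) = ip z x + ip z y.
Proof. by rewrite !(innerC z) innerDl. Qed.

Lemma innerZr a x y : ip x (a *: y) = a * ip x y.
Proof. by rewrite !(innerC x) innerZl. Qed.

Lemma innerNl x y : ip (- x) y = - ip x y.
Proof. by rewrite -scaleN1r innerZl mulN1r. Qed.

Lemma innerNr x y : ip x (- y) = - ip x y.
Proof. by rewrite -scaleN1r innerZr mulN1r. Qed.

Lemma inner0l x : ip 0 x = 0.
Proof. by rewrite -(scale0r 0) innerZl mul0r. Qed.

Lemma inner0r x : ip x 0 = 0.
Proof. by rewrite innerC inner0l. Qed.

Definition innerE := (innerDl, innerDr, innerNl, innerNr, innerZl, innerZr,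
  inner0l, inner0r).

Lemma inner_ge0 x : 0 <= ip x x.
Proof.
have [->|x0] := eqVneq x 0; first by rewrite inner0l.
exact/ltW/hB.2.
Qed.

Lemma inner_eq0 x : ip x x = 0 -> x = 0.
Proof. by move=> xx; apply/eqP/negPn/negP => /hB.2; rewrite xx ltxx. Qed.

Lemma norm2_sqr x : norm2 B x ^+ 2 = ip x x.
Proof. by rewrite sqr_sqrtr // inner_ge0. Qed.

Lemma norm2_ge0 x : 0 <= norm2 B x.
Proof. exact: sqrtr_ge0. Qed.

Lemma norm2_0 : norm2 B 0 = 0.
Proof. by rewrite /norm2 inner0l sqrtr0. Qed.

Lemma norm2_eq0 x : norm2 B x = 0 -> x = 0.
Proof. by move=> x0; apply: inner_eq0; rewrite -norm2_sqr x0 expr0n. Qed.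

Lemma norm2_gt0 x : x != 0 -> 0 < norm2 B x.
Proof. by move=> x0; rewrite sqrtr_gt0 hB.2. Qed.

Lemma inner_sqr_le x y : ip x y ^+ 2 <= ip x x * ip y y.
Proof.
have [->|y0] := eqVneq y 0; first by rewrite !inner0r expr0n mulr0.
have yy := hB.2 _ y0.
have := inner_ge0 (ip y y *: x - ip x y *: y).
rewrite !innerE (innerC y x) => h.
have {h} : 0 <= ip y y * (ip x x * ip y y - ip x y ^+ 2) by move: h; nra.
by rewrite pmulr_rge0 // subr_ge0.
Qed.

Lemma normr_inner_le x y : `|ip x y| <= norm2 B x * norm2 B y.
Proof.
rewrite -ler_sqr ?nnegrE ?mulr_ge0 ?norm2_ge0 //.
by rewrite exprMn !norm2_sqr real_normK ?num_real // inner_sqr_le.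
Qed.

Lemma inner_le x y : ip x y <= norm2 B x * norm2 B y.
Proof. exact: le_trans (ler_norm _) (normr_inner_le x y). Qed.

Lemma norm2Z a x : norm2 B (a *: x) = `|a| * norm2 B x.
Proof.
by rewrite /norm2 !innerE mulrA -expr2 sqrtrM ?sqr_ge0 // sqrtr_sqr.
Qed.

Lemma norm2N x : norm2 B (- x) = norm2 B x.
Proof. by rewrite -scaleN1r norm2Z normrN1 mul1r. Qed.

Lemma norm2_triangle x y : norm2 B (x + y) <= norm2 B x + norm2 B y.
Proof.
rewrite -ler_sqr ?nnegrE ?addr_ge0 ?norm2_ge0 // sqrrD !norm2_sqr !innerE.
rewrite (innerC y x); have := inner_le x y; lra.
Qed.

Lemma norm2_is_norm : is_norm (norm2 B).
Proof.
split; [exact: norm2_ge0|exact: norm2_eq0|exact: norm2Z|exact: norm2_triangle].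
Qed.

End InnerProduct.

(** * Equivalence of norms and continuity *)

Section NormTopology.
Variables (R : realType) (n : nat) (N : 'cV[R]_n -> R).
Hypothesis hN : is_norm N.
Implicit Types x y : 'cV[R]_n.

Lemma is_norm_ge0 x : 0 <= N x. Proof. by case: hN. Qed.
Lemma is_norm_eq0 x : N x = 0 -> x = 0. Proof. by case: hN => _ h _ _; exact: h. Qed.
Lemma is_normZ a x : N (a *: x) = `|a| * N x. Proof. by case: hN. Qed.
Lemma is_norm_triangle x y : N (x + y) <= N x + N y. Proof. by case: hN. Qed.

Lemma is_norm0 : N 0 = 0.
Proof. by rewrite -(scale0r 0) is_normZ normr0 mul0r. Qed.

Lemma is_norm_gt0 x : x != 0 -> 0 < N x.
Proof.
move=> x0; rewrite lt_neqAle is_norm_ge0 andbT eq_sym.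
by apply: contra x0 => /eqP/is_norm_eq0 ->.
Qed.

Lemma is_normN x : N (- x) = N x.
Proof. by rewrite -scaleN1r is_normZ normrN1 mul1r. Qed.

Lemma is_norm_sub_le x y : N x - N y <= N (x - y).
Proof. by have := is_norm_triangle (x - y) y; rewrite subrK; lra. Qed.

Lemma is_norm_pZ a x : 0 <= a -> N (a *: x) = a * N x.
Proof. by move=> a0; rewrite is_normZ ger0_norm. Qed.

Lemma is_norm_normalize x : x != 0 -> N ((N x)^-1 *: x) = 1.
Proof.
move=> x0; rewrite is_norm_pZ ?invr_ge0 ?is_norm_ge0 //.
by rewrite mulVf // gt_eqF // is_norm_gt0.
Qed.

Lemma is_norm_le_mx : exists2 C, 0 < C & forall x, N x <= C * `|x|.
Proof.
exists (1 + \sum_i N (delta_mx i 0)).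
  by rewrite ltr_pwDl // sumr_ge0 // => i _; exact: is_norm_ge0.
move=> x; have -> : N x = N (\sum_i x i 0 *: delta_mx i 0).
  by rewrite [in LHS](matrix_sum_delta x); congr N; apply: eq_bigr => i _;
    rewrite big_ord1.
apply: (@le_trans _ _ (\sum_i N (x i 0 *: delta_mx i 0))).
  elim/big_ind2: _ => [|a u b v au bv|//]; first by rewrite is_norm0.
  exact: le_trans (is_norm_triangle _ _) (lerD au bv).
rewrite mulrDl mul1r mulr_suml -[leLHS]add0r lerD // ler_sum // => i _.
by rewrite is_normZ mulrC ler_wpM2l ?is_norm_ge0 // ler_mx_norm.
Qed.

Lemma is_norm_continuous : continuous N.
Proof.
have [C C0 NC] := is_norm_le_mx.
move=> x A /nbhs_ballP[e /= e0 eA]; apply/nbhs_ballP; exists (e / C).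
  by rewrite /= divr_gt0.
move=> y; rewrite mx_norm_ball /ball_ /= => xy; apply: eA.
rewrite /ball /= ltr_norml.
have := is_norm_sub_le x y; have := is_norm_sub_le y x; have := NC (x - y).
rewrite -(is_normN (y - x)) opprB => h1 h2 h3.
have {}xy : C * `|x - y| < e by rewrite mulrC -ltr_pdivlMr.
by apply/andP; split; lra.
Qed.

Lemma mx_le_is_norm : exists2 C, 0 < C & forall x, `|x| <= C * N x.
Proof.
(* If the max-norm unit sphere is empty, every vector is 0 and any constant works; otherwise the
   constant is the inverse of the minimum of N on that sphere. *)
have [[x1 Nx1]|no] := pselect (exists x : 'cV[R]_n, `|x| = 1); last first.
  exists 1 => // x; have [->|x0] := eqVneq x 0; first by rewrite normr0 mul1r is_norm_ge0.
  case: no; exists (`|x|^-1 *: x).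
  by rewrite normrZ normfV normr_id mulVf // normr_eq0.
have nc : continuous (fun x : 'cV[R]_n => `|x|) by exact: norm_continuous.
have cc (c : R) : continuous (fun _ : 'cV[R]_n => c) by exact: cst_continuous.
have [|||x /= Nx xmin] := @mx_exists_min R n 1 [set x | 1 <= `|x| /\ `|x| <= 1] N 1
  is_norm_continuous.
- by apply: closedI;
  [exact: (@closed_le_fun _ _ (fun=> 1) (fun x => `|x|))|exact: (@closed_le_fun
    _ _ (fun x => `|x|) (fun=> 1))].
- by exists x1 => /=; rewrite Nx1.
- by move=> x [].
have x0 : x != 0.
  by apply: contraTneq Nx.1 => ->; rewrite normr0 -ltNge.
have Nx0 := is_norm_gt0 x0.
exists (N x)^-1; first by rewrite invr_gt0.
move=> y; have [->|y0] := eqVneq y 0; first by rewrite normr0 is_norm0 mulr0.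
have ny : 0 < `|y| by rewrite normr_gt0.
rewrite mulrC ler_pdivlMr // mulrC -ler_pdivlMr //.
have := xmin (`|y|^-1 *: y); rewrite is_norm_pZ ?invr_ge0 // mulrC; apply.
by rewrite /= normrZ normfV normr_id mulVf ?gt_eqF.
Qed.

End NormTopology.

Section InnerContinuity.
Variables (R : realType) (n : nat) (B : 'M[R]_n).
Hypothesis hB : sym_posdef B.

Lemma inner_continuous (g : 'cV[R]_n) : continuous (fun x => inner B g x).
Proof.
have [C C0 NC] := is_norm_le_mx (norm2_is_norm hB).
move=> x A /nbhs_ballP[e /= e0 eA]; apply/nbhs_ballP.
have K0 : 0 < (norm2 B g + 1) * C by rewrite mulr_gt0 // ltr_wpDl ?norm2_ge0.
exists (e / ((norm2 B g + 1) * C)); first by rewrite /= divr_gt0.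
move=> y; rewrite mx_norm_ball /ball_ /= => xy; apply: eA; rewrite /ball /=.
rewrite -innerNr // -innerDr //; apply: le_lt_trans (normr_inner_le hB _ _) _.
apply: (@le_lt_trans _ _ ((norm2 B g + 1) * C * `|x - y|)).
  rewrite -mulrA; apply: ler_pM; [exact: norm2_ge0|exact: norm2_ge0| |exact: NC].
  by rewrite lerDl.
by rewrite mulrC -ltr_pdivlMr.
Qed.

Lemma norm2_continuous : continuous (norm2 B).
Proof. exact: is_norm_continuous (norm2_is_norm hB). Qed.

Lemma inner_diag_continuous : continuous (fun x => inner B x x).
Proof.
have -> : (fun x => inner B x x) = (fun x => norm2 B x * norm2 B x).
  by apply/funext => x; rewrite -expr2 norm2_sqr.
by move=> x; apply: continuousM; exact: norm2_continuous.
Qed.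

End InnerContinuity.

(** * Orthogonal projection and orthonormal families *)

Section OrthogonalProjection.
Variables (R : realType) (n : nat) (B : 'M[R]_n).
Hypothesis hB : sym_posdef B.
Local Notation ip := (inner B).

Lemma orth_sum (I : Type) (r : seq I) (P : pred I) (F : I -> 'cV[R]_n) v :
  (forall i, P i -> ip (F i) v = 0) -> ip (\sum_(i <- r | P i) F i) v = 0.
Proof.
move=> h; elim/big_ind: _ => [|x y hx hy|i Pi]; first by rewrite inner0l.
  by rewrite innerDl hx hy addr0.
exact: h.
Qed.

Lemma orth_span (s : seq 'cV[R]_n) v :
  (forall u, u \in s -> ip u v = 0) -> orth B <<s>>%VS v.
Proof.
move=> sv u /(@coord_span _ _ _ (in_tuple s)) ->.
apply: orth_sum => i _; rewrite innerZl sv ?mulr0 //.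
by apply: mem_nth; case: i.
Qed.

(** Gram-Schmidt along a spanning list. If the new vector depends on the earlier ones, then d = 0
    and the added term vanishes. *)
Lemma orth_projection (V : {vspace 'cV[R]_n}) x :
  exists2 u, u \in V & orth B V (x - u).
Proof.
suff H (s : seq 'cV[R]_n) : forall x, exists2 u, u \in <<s>>%VS & orth B <<s>>%VS (x - u).
  by have [u uV xu] := H (vbasis V) x; rewrite (span_basis (vbasisP V)) in uV xu;
    exists u.
elim: s => [y|w s IH y].
  exists 0; first exact: mem0v.
  by apply: orth_span => u; rewrite in_nil.
have [u us yu] := IH y; have [w' ws ww] := IH w.
have sub : (<<s>> <= <<w :: s>>)%VS by apply: sub_span => z zs; rewrite inE zs orbT.
have w_in : w \in <<w :: s>>%VS by rewrite memv_span // mem_head.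
set d := w - w' in ww *; have d_in : d \in <<w :: s>>%VS.
  by rewrite /d rpredB //; exact: subvP sub _ ws.
exists (u + (ip d (y - u) / ip d d) *: d).
  by rewrite rpredD ?rpredZ //; exact: subvP sub _ us.
apply: orth_span => z; rewrite inE => /orP[/eqP ->|zs]; last first.
  rewrite opprD addrA innerDr // innerNr // innerZr //.
  by rewrite (yu z (memv_span zs)) (ww z (memv_span zs)) mulr0 oppr0 addr0.
have -> : w = d + w' by rewrite /d subrK.
rewrite innerDl opprD addrA; move: (y - u) (yu _ ws) => q wq; clearbody d.
rewrite !innerDr // !innerNr // !innerZr // (ww _ ws) wq mulr0 oppr0 !addr0.
have [d0|d0] := eqVneq d 0; first by rewrite d0 !inner0l !mul0r subrr.
by rewrite divfK ?subrr // gt_eqF // hB.2.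
Qed.

(** The Gram matrix is the identity, of rank p, and factors through dimension n. This bounds the
    number of atoms that can be peeled off. *)
Lemma orthonormal_size (p : nat) (X : 'M[R]_(n, p)) :
  (forall i j, ip (col i X) (col j X) = (i == j)%:R) -> (p <= n)%N.
Proof.
move=> h; have XX : X^T *m B *m X = 1%:M.
  apply/matrixP => i j; rewrite [RHS]mxE -h /inner.
  rewrite tr_col -row_mul; rewrite !mxE; apply: eq_bigr => k _.
  by rewrite !mxE.
rewrite -(mxrank1 R p) -XX; apply: leq_trans (mxrankM_maxr _ _) _.
exact: rank_leq_row.
Qed.

End OrthogonalProjection.

(** * Atoms, the dual ball and decomposability *)

Section Geometry.
Variables (R : realType) (n : nat) (B : 'M[R]_n) (N : 'cV[R]_n -> R)
  (T : 'cV[R]_n -> {vspace 'cV[R]_n}) (e : 'cV[R]_n -> 'cV[R]_n).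
Hypotheses (hB : sym_posdef B) (hN : is_norm N)
  (hext : forall a, extreme_point [set y | N y <= 1] a -> norm2 B a = 1)
  (hdec : decomposable B N T e).
Local Notation ip := (inner B).
Local Notation W x := (orth B (T x)).
Implicit Types x y z u v w a g : 'cV[R]_n.

(** The unit ball of the dual norm, stated without a supremum; see [dual_norm_le1]. *)
Definition dual_ball g := forall y, ip g y <= N y.

(** The extreme points of the unit ball, encoded by closed conditions so that compactness applies to
    families of atoms. *)
Definition atom a := N a <= 1 /\ ip a a = 1.

Lemma ball_bounded : exists C, forall x, N x <= 1 -> `|x| <= C.
Proof.
have [C C0 h] := mx_le_is_norm hN; exists C => x Nx.
by apply: le_trans (h x) _; rewrite -[leRHS]mulr1 ler_wpM2l // ltW.
Qed.

Lemma N_convex t x y : 0 <= t <= 1 -> N (t *: x + (1 - t) *: y) <= t * N x + (1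
  - t) * N y.
Proof.
move=> /andP[t0 t1]; apply: le_trans (is_norm_triangle hN _ _) _.
by rewrite !is_norm_pZ // subr_ge0.
Qed.

(* The point of S farthest from the origin is extreme in the unit ball. *)
Lemma face_atom (S : set 'cV[R]_n) :
  closed S -> S !=set0 -> (forall y, S y -> N y <= 1) ->
  (forall y1 y2 t, N y1 <= 1 -> N y2 <= 1 -> 0 < t < 1 ->
    S (t *: y1 + (1 - t) *: y2) -> S y1 /\ S y2) ->
  exists a, [/\ S a, atom a & forall y, S y -> ip y y <= 1].
Proof.
move=> cS S0 SN face; have [C hC] := ball_bounded.
have cf : continuous (fun x => - ip x x).
  exact/continuous_opp/inner_diag_continuous.
have [a Sa amax] := mx_exists_min cf cS S0 (fun x Sx => hC x (SN x Sx)).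
have a1 : norm2 B a = 1.
  apply: hext; split; first exact: SN.
  move=> x y t Nx Ny t01 aE; have [Sx Sy] : S x /\ S y.
    by apply: (face x y t) => //; rewrite -aE.
  have := amax _ Sx; have := amax _ Sy; rewrite !lerN2 => hy hx.
  have xy : ip (x - y) (x - y) = 0.
    apply: le_anti; rewrite inner_ge0 // andbT; move: t01 => /andP[t0 t1].
    have : ip a a = t * ip x x + (1 - t) * ip y y - t * (1 - t) * ip (x - y) (x - y).
      by rewrite aE !(innerE hB) (innerC hB y x); ring.
    move=> aa; have tt : 0 < t * (1 - t) by rewrite mulr_gt0 // subr_gt0.
    rewrite -(pmulr_rle0 _ tt); nra.
  have {}xy : x = y by apply/eqP; rewrite -subr_eq0; apply/eqP/(inner_eq0 hB).
  by rewrite aE xy -scalerDl addrCA subrr addr0 scale1r.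
have aa : ip a a = 1 by rewrite -norm2_sqr // a1 expr1n.
by exists a; split=> // [|y /amax]; [split=> //; exact: SN|rewrite lerN2 aa].
Qed.

Lemma ball_closed : closed [set x | N x <= 1].
Proof.
by apply: (@closed_le_fun _ _ N (fun=> 1));
  [exact: is_norm_continuous|exact: cst_continuous].
Qed.

Lemma inner_ge_closed g c : closed [set x | c <= ip g x].
Proof.
apply: (@closed_le_fun _ _ (fun=> c) (ip g));
  [exact: cst_continuous|exact: inner_continuous].
Qed.

Lemma ball_nonempty : [set x | N x <= 1] !=set0.
Proof. by exists 0; rewrite /= (is_norm0 hN). Qed.

(** The maximisers of <g, .> on the ball form a face, and [face_atom] finds an atom there; <g, a> is
    then the dual norm of g. *)
Lemma atom_max g : exists2 a, atom a & forall y, ip g y <= ip g a * N y.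
Proof.
have [C hC] := ball_bounded.
have cf : continuous (fun x => - ip g x).
  exact/continuous_opp/inner_continuous.
have [m Sm mmax] := mx_exists_min cf ball_closed ball_nonempty hC.
have {}mmax y : N y <= 1 -> ip g y <= ip g m by move=> /mmax; rewrite lerN2.
have [|||y1 y2 t N1 N2 /andP[t0 t1]|a [[Na ga] ata _]] :=
  @face_atom ([set x | N x <= 1] `&` [set x | ip g m <= ip g x]).
- by apply: closedI; [exact: ball_closed|exact: inner_ge_closed].
- by exists m; split => /=.
- by move=> y [].
- move=> [_ /=]; rewrite !(innerE hB) => h.
  have h1 := mmax _ N1; have h2 := mmax _ N2.
  by split; split=> //=; nra.
exists a => // y; rewrite /= in ga.
have [->|y0] := eqVneq y 0; first by rewrite (inner0r hB) is_norm0 // mulr0.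
have Ny := is_norm_gt0 hN y0.
rewrite -ler_pdivrMr //; apply: le_trans ga.
rewrite mulrC -(innerZr hB); apply: mmax.
by rewrite is_norm_normalize.
Qed.

(** [face_atom] for the whole ball: its farthest point from 0 has Euclidean norm 1. *)
Lemma norm2_le_N x : norm2 B x <= N x.
Proof.
have [||//||a [_ _ h]] := @face_atom [set x | N x <= 1].
- exact: ball_closed.
- exact: ball_nonempty.
- by [].
have [->|x0] := eqVneq x 0; first by rewrite norm2_0 is_norm0.
have Nx := is_norm_gt0 hN x0.
have /h : N ((N x)^-1 *: x) <= 1 by rewrite is_norm_normalize.
have Ni : 0 <= (N x)^-1 by rewrite invr_ge0 ltW.
rewrite -norm2_sqr // norm2Z // ger0_norm // -[leRHS](expr1n _ 2).
rewrite ler_sqr ?nnegrE ?mulr_ge0 ?norm2_ge0 //.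
by rewrite mulrC ler_pdivrMr // mul1r.
Qed.

Lemma inner_le_N x : ip x x <= N x ^+ 2.
Proof.
rewrite -norm2_sqr // ler_sqr ?nnegrE ?norm2_ge0 ?is_norm_ge0 //; exact: norm2_le_N.
Qed.

Lemma dual_ball_euclid g : ip g g <= 1 -> dual_ball g.
Proof.
move=> g1 y; apply: le_trans (inner_le hB _ _) _.
have {}g1 : norm2 B g <= 1.
  by rewrite -ler_sqr ?nnegrE ?norm2_ge0 // norm2_sqr // expr1n.
have := norm2_le_N y; have := norm2_ge0 B y; have := norm2_ge0 B g; nra.
Qed.

Lemma atom_N a : atom a -> N a = 1.
Proof.
move=> [Na aa]; apply: le_anti; rewrite Na /=.
have := inner_le_N a; have := is_norm_ge0 hN a; rewrite aa; nra.
Qed.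

Lemma atom_dual_ball a : atom a -> dual_ball a.
Proof. by move=> [_ aa]; apply: dual_ball_euclid; rewrite aa. Qed.

Lemma dual_ballN g : dual_ball g -> dual_ball (- g).
Proof. by move=> hg y; rewrite innerNl -innerNr // -(is_normN hN) //; exact: hg. Qed.

Lemma dual_ball_scale g : exists2 s, 0 < s & dual_ball (s *: g).
Proof.
have [a ata ga] := atom_max g.
have ga0 : 0 <= ip g a.
  by have := ga (- a); rewrite innerNr // is_normN // atom_N //; lra.
exists (ip g a + 1)^-1; first by rewrite invr_gt0; lra.
move=> y; rewrite innerZl mulrC ler_pdivrMr; last by lra.
have := ga y; have := is_norm_ge0 hN y; nra.
Qed.

Lemma subdiffP x g : subdiff B N x g <-> dual_ball g /\ ip g x = N x.
Proof.
split=> [h|[hg gx] y]; last by rewrite innerDr // innerNr // gx; have := hg y; lra.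
have gx : ip g x = N x.
  (* By homogeneity the test points 0 and 2x give the two inequalities. *)
  have := h 0; have := h (2 *: x).
  rewrite sub0r is_norm0 // is_norm_pZ // !(innerE hB); lra.
by split=> // y; have := h y; rewrite innerDr // innerNr // gx; lra.
Qed.

Lemma dual_norm_atom g a : atom a -> (forall y, ip g y <= ip g a * N y) ->
  dual_norm B N g = ip g a.
Proof.
move=> ata ga; have ga0 : 0 <= ip g a.
  by have := ga (- a); rewrite innerNr // is_normN // atom_N //; lra.
rewrite /dual_norm; apply: le_anti; apply/andP; split.
  apply: ge_sup; first by exists (ip g 0), 0 => //=; rewrite is_norm0.
  by move=> _ [y /= Ny <-]; have := ga y; nra.
apply: ub_le_sup; last by exists a => //; exact: ata.1.
by exists (ip g a) => _ [y /= Ny <-]; have := ga y; nra.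
Qed.

Lemma inner_le_dual g y : ip g y <= dual_norm B N g * N y.
Proof. by have [a ata ga] := atom_max g; rewrite (dual_norm_atom ata ga). Qed.

Lemma dual_norm_le g c : (forall a, atom a -> ip g a <= c) -> dual_norm B N g <= c.
Proof. by have [a ata ga] := atom_max g; rewrite (dual_norm_atom ata ga); apply. Qed.

Lemma dual_norm_ge0 g : 0 <= dual_norm B N g.
Proof.
have [a ata ga] := atom_max g; rewrite (dual_norm_atom ata ga).
by have := ga (- a); rewrite innerNr // is_normN // atom_N //; lra.
Qed.

Lemma dual_norm_le1 g : dual_norm B N g <= 1 <-> dual_ball g.
Proof.
split=> [g1 y|hg]; last by apply: dual_norm_le => a ata; rewrite -(atom_N ata).
by apply: le_trans (inner_le_dual g y) _; rewrite -[leRHS]mul1r ler_wpM2r ?is_norm_ge0.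
Qed.

Lemma decP x g : dual_ball g -> ip g x = N x ->
  exists v, [/\ W x v, dual_ball v & g = e x + v].
Proof.
move=> hg gx; have : subdiff B N x g by apply/subdiffP.
by rewrite (hdec x).2 => -[v [Wv /dual_norm_le1 v1] <-]; exists v.
Qed.

Lemma decP_inv x v : W x v -> dual_ball v -> dual_ball (e x + v) /\ ip (e x + v) x = N x.
Proof.
move=> Wv hv; apply/subdiffP; rewrite (hdec x).2; exists v => //.
by split=> //; apply/dual_norm_le1.
Qed.

Lemma orth0 x : W x 0. Proof. by move=> u _; rewrite inner0r. Qed.
Lemma orthD x u v : W x u -> W x v -> W x (u + v).
Proof. by move=> hu hv w wT; rewrite innerDr // hu // hv // addr0. Qed.
Lemma orthZ x c v : W x v -> W x (c *: v).
Proof. by move=> hv w wT; rewrite innerZr // hv // mulr0. Qed.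
Lemma orthN x v : W x v -> W x (- v).
Proof. by move=> hv; rewrite -scaleN1r; exact: orthZ. Qed.

Lemma dual_ball0 : dual_ball 0.
Proof. by move=> y; rewrite inner0l is_norm_ge0. Qed.

Lemma e_dual_ball x : dual_ball (e x).
Proof. by have [] := decP_inv (@orth0 x) dual_ball0; rewrite addr0. Qed.

Lemma e_inner x : ip (e x) x = N x.
Proof. by have [] := decP_inv (@orth0 x) dual_ball0; rewrite addr0. Qed.

Lemma e_orth x v : W x v -> ip (e x) v = 0.
Proof. by apply; exact: (hdec x).1. Qed.

(** For small s > 0 both e x + s v and e x - s v are in the dual ball, while e x alone already
    attains N y at y. *)
Lemma face_orth x y v : ip (e x) y = N y -> W x v -> ip y v = 0.
Proof.
move=> ey Wv; have [s s0 sv] := dual_ball_scale v.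
have [h1 _] := decP_inv (orthZ s Wv) sv.
have [h2 _] := decP_inv (orthN (orthZ s Wv)) (dual_ballN sv).
have := h1 y; have := h2 y; rewrite !(innerE hB) ey (innerC hB v y) => h3 h4.
have : s * ip y v = 0 by lra.
by move/eqP; rewrite mulf_eq0 gt_eqF //= => /eqP.
Qed.

Lemma e_unique x s : dual_ball s -> ip s x = N x ->
  (forall v, W x v -> dual_ball v -> ip s v = 0) -> s = e x.
Proof.
move=> hs sx sW; have [v [Wv hv sE]] := decP hs sx.
suff v0 : v = 0 by rewrite sE v0 addr0.
apply: (inner_eq0 hB); have := sW v Wv hv.
by rewrite sE innerDl e_orth // add0r.
Qed.

(** This makes decomposability usable at a: [atom_add] and [atom_dec] below are the two directions
    of the description of the dual-ball vectors with value 1 at a. *)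
Lemma atom_e a : atom a -> e a = a.
Proof.
move=> ata; apply/esym/e_unique; first exact: atom_dual_ball.
  by rewrite ata.2 atom_N.
by move=> v Wv _; apply: face_orth Wv; rewrite e_inner.
Qed.

Lemma atom_orth a v : atom a -> W a v -> ip a v = 0.
Proof. by move=> ata Wv; rewrite -{1}(atom_e ata) e_orth. Qed.

Lemma atom_add a v : atom a -> W a v -> dual_ball v -> dual_ball (a + v).
Proof. by move=> ata Wv hv; rewrite -{1}(atom_e ata); have [] := decP_inv Wv hv. Qed.

Lemma atom_dec a g : atom a -> dual_ball g -> ip g a = 1 -> W a (g - a) /\
  dual_ball (g - a).
Proof.
move=> ata hg ga; have [|v [Wv hv ->]] := decP hg (x := a); first by rewrite atom_N.
by rewrite atom_e // addrAC subrr add0r.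
Qed.

(** Let w be v scaled so that <w, a> = 1. Since w + e x and w - e x are in the dual ball, <e x, a> =
    0 and both have value 1 at a; half the difference of their components in W a is e x, so e x is
    in W a. Then a + e x and a - e x are in the dual ball, so <a, x> = 0, and the subgradient a + e
    x at x shows that a is in W x. *)
Lemma orth_max x v a : W x v -> v != 0 -> atom a ->
  (forall y, ip v y <= ip v a * N y) -> W x a.
Proof.
move=> Wv v0 ata va.
have s0 : 0 < ip v a.
  have := va v; have := hB.2 _ v0; have := is_norm_gt0 hN v0 => Nv vv.
  by move=> /(lt_le_trans vv); rewrite pmulr_lgt0.
pose w := (ip v a)^-1 *: v; have Ww : W x w by exact: orthZ.
have hw : dual_ball w.
  by move=> y; rewrite innerZl mulrC ler_pdivrMr // mulrC.
have wa : ip w a = 1 by rewrite innerZl mulVf // gt_eqF.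
clearbody w.
have [p1 _] := decP_inv Ww hw.
have [p2 _] := decP_inv (orthN Ww) (dual_ballN hw).
have {}p2 : dual_ball (w - e x) by have := dual_ballN p2; rewrite opprD opprK addrC.
have ea : ip (e x) a = 0.
  have := p1 a; have := p2 a; rewrite !(innerE hB) wa atom_N //; lra.
have [|W1 _] := atom_dec ata p1; first by rewrite innerDl ea wa add0r.
have [|W2 _] := atom_dec ata p2; first by rewrite innerDl innerNl ea wa oppr0 addr0.
have We : W a (e x).
  have -> : e x = 2^-1 *: ((e x + w - a) - (w - e x - a)).
    by apply/colP => i; rewrite !mxE; lra.
  by apply: orthZ; apply: orthD => //; exact: orthN.
have q1 := atom_add ata We (@e_dual_ball x).
have q2 := atom_add ata (orthN We) (dual_ballN (@e_dual_ball x)).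
have ax : ip a x = 0.
  have := q1 x; have := dual_ballN q2 x; rewrite !(innerE hB) e_inner; lra.
have [|v' [Wv' _ E]] := decP q1 (x := x); first by rewrite innerDl ax add0r e_inner.
suff -> : a = v' by [].
by move/eqP: E; rewrite addrC (inj_eq (addrI _)) => /eqP.
Qed.

(* frame x s p: x is a positive combination of p mutually orthogonal atoms
   whose sum is s. *)
Inductive frame : 'cV[R]_n -> 'cV[R]_n -> nat -> Prop :=
| frame_nil : frame 0 0 0
| frame_cons a c x s p : atom a -> 0 < c -> W a x -> W a s -> frame x s p ->
    frame (c *: a + x) (a + s) p.+1.

(** * Frames: orthogonal decompositions into atoms *)

Lemma frame_dual_ball x s p : frame x s p -> dual_ball s.
Proof.
elim=> [|a c {}x {}s {}p ata c0 Wx Ws _ IH]; first exact: dual_ball0.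
exact: atom_add.
Qed.

Lemma frame_inner x s p : frame x s p -> ip s s = p%:R.
Proof.
elim=> [|a c {}x {}s {}p ata c0 Wx Ws _ IH]; first by rewrite inner0l.
by rewrite !(innerE hB) IH (innerC hB s a) !(atom_orth ata Ws) ata.2 -natr1; lra.
Qed.

Lemma frame_norm x s p : frame x s p -> N x = ip s x.
Proof.
elim=> [|a c {}x {}s {}p ata c0 Wx Ws fx IH]; first by rewrite inner0l is_norm0.
have sum : ip (a + s) (c *: a + x) = c + N x.
  rewrite !(innerE hB) (innerC hB s a) (atom_orth ata Ws) (atom_orth ata Wx) ata.2 -IH.
  lra.
rewrite sum; apply: le_anti; apply/andP; split.
  apply: le_trans (is_norm_triangle hN _ _) _.
  by rewrite (is_norm_pZ hN _ (ltW c0)) atom_N // mulr1.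
rewrite -sum; apply: (atom_add ata Ws); exact: frame_dual_ball fx.
Qed.

Lemma frame_norm_dual x s p : frame x s p -> N s <= p%:R.
Proof.
elim=> [|a c {}x {}s {}p ata c0 Wx Ws fx IH]; first by rewrite is_norm0.
by apply: le_trans (is_norm_triangle hN _ _) _; rewrite atom_N // -natr1; lra.
Qed.

Lemma frame_consN a c x s p : atom a -> 0 < c -> W a x -> W a s -> frame x s p ->
  N (c *: a + x) = c + N x.
Proof.
move=> ata c0 Wx Ws fx; rewrite (frame_norm (frame_cons ata c0 Wx Ws fx)).
rewrite !(innerE hB) (innerC hB s a) (atom_orth ata Ws) (atom_orth ata Wx) ata.2.
rewrite (frame_norm fx); lra.
Qed.

(** N is additive along a frame and <g, .> is at most N on each term, so equality of the sums forces
    equality termwise; c > 0 is needed to cancel it. *)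
Lemma frame_cons_aligned a c x s p g : atom a -> 0 < c -> W a x -> W a s ->
  frame x s p -> dual_ball g -> ip g (c *: a + x) = N (c *: a + x) ->
  ip g a = 1 /\ ip g x = N x.
Proof.
move=> ata c0 Wx Ws fx hg; rewrite (frame_consN ata c0 Wx Ws fx) !(innerE hB) => gE.
have := hg a; have := hg x; rewrite (atom_N ata) => gx ga.
have ga1 : ip g a = 1.
  apply: le_anti; rewrite ga /= -(ler_pM2l c0) mulr1; lra.
by split=> //; move: gE; rewrite ga1; lra.
Qed.

Lemma frame_aligned x s p g : frame x s p -> dual_ball g -> ip g x = N x ->
  ip g s = p%:R.
Proof.
move=> fx hg; elim: fx => [_|a c {}x {}s {}p ata c0 Wx Ws fx IH gx].
  by rewrite inner0r.
have [ga {}gx] := frame_cons_aligned ata c0 Wx Ws fx hg gx.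
by rewrite innerDr // ga IH // -natr1 addrC.
Qed.

Lemma frame_e x s p : frame x s p -> s = e x.
Proof.
move=> fx; apply: e_unique; first exact: frame_dual_ball fx.
  by rewrite (frame_norm fx).
move=> v Wv hv; have [h1 h2] := decP_inv Wv hv.
have := frame_aligned fx h1 h2; have := frame_aligned fx (@e_dual_ball x) (@e_inner x).
by rewrite innerDl (innerC hB s v) => ->; lra.
Qed.

Lemma frame_atoms x s p : frame x s p ->
  exists (X : 'M[R]_(n, p)) (b : 'cV[R]_p),
    [/\ forall j, atom (col j X), forall j, 0 <= b j 0 & x = X *m b].
Proof.
elim=> [|a c {}x {}s {}p ata c0 Wx Ws fx [X [b [atX b0 xE]]]].
  by exists 0, 0; split; [case|case|rewrite mul0mx].
suff [h1 h2 h3] : [/\ forall j, atom (col j (row_mx a X)),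
    forall j, 0 <= (col_mx (c%:M : 'M_1) b) j 0 &
    c *: a + x = row_mx a X *m col_mx (c%:M : 'M_1) b].
  by exists (row_mx a X), (col_mx (c%:M : 'M_1) b).
split.
- move=> j; case: (split_ordP j) => k ->; last by rewrite colKr.
  by rewrite colKl; have -> : col k a = a by apply/colP => i; rewrite mxE ord1.
- move=> j; case: (split_ordP j) => k ->; last by rewrite col_mxEd.
  by rewrite col_mxEu mxE ord1 eqxx mulr1n ltW.
- by rewrite mul_row_col mul_mx_scalar xE.
Qed.

(** Divided by its dual norm <x, a>, x becomes a dual-ball vector with value 1 at a, from which
    [atom_dec] splits off a. *)
Lemma max_residual_orth x a : atom a -> (forall y, ip x y <= ip x a * N y) ->
  x != 0 -> 0 < ip x a /\ W a (x - ip x a *: a).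
Proof.
move=> ata xa x0.
have c0 : 0 < ip x a.
  have := xa x; have := hB.2 _ x0; have := is_norm_gt0 hN x0 => Nv vv.
  by move=> /(lt_le_trans vv); rewrite pmulr_lgt0.
split=> //; have h : dual_ball ((ip x a)^-1 *: x).
  by move=> y; rewrite innerZl mulrC ler_pdivrMr // mulrC.
have [|Wv _] := atom_dec ata h; first by rewrite innerZl mulVf // gt_eqF.
have -> : x - ip x a *: a = ip x a *: ((ip x a)^-1 *: x - a).
  by rewrite scalerBr scalerA mulfV ?scale1r // gt_eqF.
exact: orthZ.
Qed.

(** The clause on W closes the recursion: the residual lies in W a, and the frame sum found for it
    must lie there too. *)
Lemma frame_exists x :
  exists s p, frame x s p /\ forall y, W y x -> W y s.
Proof.
(* X holds the atoms already peeled off, and d is the fuel: at d = 0 there would be more than n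
   orthonormal columns. *)
suff H d : forall p (X : 'M[R]_(n, p)) x, (n < p + d)%N ->
    (forall i j, ip (col i X) (col j X) = (i == j)%:R) ->
    (forall j, atom (col j X)) -> (forall j, W (col j X) x) ->
    exists s p, frame x s p /\ forall y, W y x -> W y s.
  by apply: (H n.+1 0%N 0 x); [rewrite add0n|case|case|case].
elim: d => [|d IH] p X {}x np Xo Xat XW.
  by have := orthonormal_size Xo; rewrite leqNgt -[p]addn0 np.
have [->|x0] := eqVneq x 0.
  by exists 0, 0%N; split; [exact: frame_nil|move=> y _; exact: orth0].
have [a ata xa] := atom_max x.
have [c0 Wx1] := max_residual_orth ata xa x0.
pose x1 := x - ip x a *: a.
have WyA y : W y x -> W y a by move=> Wy; exact: (orth_max Wy x0 ata xa).
have WyX y : W y x -> W y x1.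
  by move=> Wy; apply: orthD => //; apply: orthN; apply: orthZ; exact: WyA.
have Xa j : ip (col j X) a = 0 by apply: atom_orth => //; exact: WyA.
have cola (k : 'I_1) : col k a = a by apply/colP => i; rewrite mxE ord1.
have [||||s [q [fx1 hs]]] := IH (p + 1)%N (row_mx X a) x1.
- by rewrite -addnA add1n.
- move=> i j; case: (split_ordP i) => k ->; case: (split_ordP j) => l ->;
    rewrite ?colKl ?colKr ?cola.
  + by rewrite Xo.
  + by rewrite Xa eq_lrshift.
  + by rewrite (innerC hB) Xa eq_rlshift.
  + by rewrite !ord1 eqxx ata.2.
- move=> j; case: (split_ordP j) => k ->; rewrite ?colKl ?colKr ?cola //.
- move=> j; case: (split_ordP j) => k ->; rewrite ?colKl ?colKr ?cola //.
  exact: WyX.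
exists (a + s), q.+1; split=> [|y Wy]; last by apply: orthD; [exact: WyA|exact/hs/WyX].
have -> : x = ip x a *: a + x1 by rewrite /x1 addrC subrK.
by apply: frame_cons => //; exact: hs.
Qed.

Lemma orth_aligned x v : W x v -> exists s, [/\ W x s, dual_ball s & ip s v = N v].
Proof.
move=> Wv; have [s [p [fv hs]]] := frame_exists v.
exists s; split; [exact: hs|exact: frame_dual_ball fv|by rewrite (frame_norm fv)].
Qed.

(* These are the e x, the analogues of partial isometries; ip s s is the rank. *)
Definition tripotent s := dual_ball s /\ N s <= ip s s.

Lemma frame_tripotent x s p : frame x s p -> tripotent s.
Proof.
move=> fx; split; first exact: frame_dual_ball fx.
by rewrite (frame_inner fx); exact: frame_norm_dual fx.
Qed.

Lemma e_tripotent x : tripotent (e x).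
Proof.
by have [s [p [fx _]]] := frame_exists x; rewrite -(frame_e fx);
  exact: frame_tripotent fx.
Qed.

Lemma tripotent_norm s : tripotent s -> N s = ip s s.
Proof. by move=> [hs Ns]; apply: le_anti; rewrite Ns hs. Qed.

(** Let t in W a attain the norm of s - a. Then a + t is in the dual ball, and its value 1 + N (s -
    a) at s is at most N s <= <s, s>. *)
Lemma tripotent_sub s a : tripotent s -> atom a -> ip s a = 1 ->
  [/\ W a (s - a), tripotent (s - a) & ip (s - a) (s - a) = ip s s - 1].
Proof.
move=> [hs Ns] ata sa; have [Wv hv] := atom_dec ata hs sa.
have vv : ip (s - a) (s - a) = ip s s - 1.
  by rewrite !(innerE hB) ata.2 (innerC hB a s) sa; lra.
split=> //; split=> //; have [t [Wt ht tv]] := orth_aligned Wv.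
have key : ip (a + t) (a + (s - a)) = 1 + N (s - a).
  move: (s - a) Wv tv => v Wv tv.
  by rewrite !(innerE hB) ata.2 (atom_orth ata Wv) (innerC hB t) (atom_orth ata
    Wt) tv; lra.
have := atom_add ata Wt ht s; rewrite -{1}(subrKC a s) key vv; lra.
Qed.

Lemma face_sub s a y : dual_ball s -> atom a -> ip s a = 1 -> ip (s - a) y = N y ->
  ip a y = 0 /\ ip s y = N y.
Proof.
move=> hs ata sa vy; have [Wv hv] := atom_dec ata hs sa.
have h1 := atom_add ata Wv hv y;
  have := dual_ballN (atom_add ata (orthN Wv) (dual_ballN hv)) y.
move: vy h1; rewrite !(innerE hB) => h1 h2 h3; split; lra.
Qed.

(** Write s = y + v with v in W y. The dual-ball vector y - v = 2y - s has value at least -1 at a,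
    while <s, a> = 1. *)
Lemma face_atom_inner_ge0 s a y : dual_ball s -> atom a -> atom y ->
  ip s a = 1 -> ip s y = 1 -> 0 <= ip a y.
Proof.
move=> hs ata aty sa sy; have [Wv hv] := atom_dec aty hs sy.
have := dual_ballN (atom_add aty (orthN Wv) (dual_ballN hv)) a.
by rewrite !(innerE hB) sa (atom_N ata) (innerC hB y a); lra.
Qed.

(** All atoms of the frame pair nonnegatively with y, so <x, y> is at least the least coefficient
    times <s, y> = 1. *)
Lemma face_atom_inner_gt0 x s p y : frame x s p -> atom y -> ip s y = 1 -> 0 < ip x y.
Proof.
move=> fx aty sy; have hs := frame_dual_ball fx.
have sx := esym (frame_norm fx).
suff [m m0 xm] : exists2 m, 0 < m & m * ip s y <= ip x y.
  by apply: lt_le_trans xm; rewrite sy mulr1.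
have pos a : atom a -> ip s a = 1 -> 0 <= ip a y.
  by move=> ata sa; exact: (face_atom_inner_ge0 hs).
(* S is the sum of the full frame and stays fixed while the induction runs through its tails. *)
clear sy; move: {1 2 3}s hs sx pos => S hS Sx pos.
suff [] : 0 <= ip s y /\ exists2 m, 0 < m & m * ip s y <= ip x y by [].
elim: fx Sx => [_|a c {}x {}s {}p ata c0 Wx Ws fx IH Sx].
  by rewrite !inner0l; split=> //; exists 1; rewrite ?mulr0.
have [Sa {}Sx] := frame_cons_aligned ata c0 Wx Ws fx hS Sx.
have [sy0 [m m0 my]] := IH Sx; have ay := pos _ ata Sa.
rewrite !(innerE hB); split; first exact: addr_ge0.
exists (Num.min c m); first by rewrite lt_min c0.
rewrite mulrDr; apply: lerD; first by rewrite ler_wpM2r // ge_min lexx.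
by apply: le_trans my; rewrite ler_wpM2r // ge_min lexx orbT.
Qed.

Lemma max_residual x a : atom a -> (forall y, ip x y <= ip x a * N y) -> x != 0 ->
  W a (x - ip x a *: a) /\ N x = ip x a + N (x - ip x a *: a).
Proof.
move=> ata xa x0.
have [c0 Wx1] := max_residual_orth ata xa x0.
split=> //; have [s [Ws hs sx]] := orth_aligned Wx1.
apply: le_anti; apply/andP; split.
  rewrite -{1}(subrKC (ip x a *: a) x); apply: le_trans (is_norm_triangle hN _ _) _.
  by rewrite (is_norm_pZ hN _ (ltW c0)) (atom_N ata) mulr1.
apply: le_trans (atom_add ata Ws hs x).
rewrite -sx !(innerE hB) (innerC hB s a) (atom_orth ata Ws) (innerC hB a x); lra.
Qed.

(** * Compactness of the dual ball and first-order motion of atoms *)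

Lemma N_le_norm2 : exists2 C, 0 < C & forall x, N x <= C * norm2 B x.
Proof.
have [C C0 h] := is_norm_le_mx hN; have [D D0 k] := mx_le_is_norm (norm2_is_norm hB).
exists (C * D); first exact: mulr_gt0.
by move=> x; apply: le_trans (h x) _; rewrite -mulrA ler_wpM2l // ltW.
Qed.

Lemma dual_ball_bounded : exists C, forall g, dual_ball g -> `|g| <= C.
Proof.
have [C C0 h] := N_le_norm2; have [D D0 k] := mx_le_is_norm (norm2_is_norm hB).
exists (D * C) => g hg; apply: le_trans (k g) _; apply: ler_wpM2l; first exact: ltW.
have := le_trans (hg g) (h g); rewrite -norm2_sqr // expr2.
have [->|] := eqVneq g 0; first by rewrite norm2_0 => _; exact: ltW.
by move=> /(norm2_gt0 hB) g0; rewrite ler_pM2r.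
Qed.

Lemma dual_ball_closed : closed dual_ball.
Proof.
have -> : dual_ball = \bigcap_y [set g | ip y g <= N y].
  apply/seteqP; split=> g hg; first by move=> y _ /=; rewrite innerC.
  by move=> y; rewrite innerC //; exact: hg y I.
apply: closed_bigI => y _.
apply: (@closed_le_fun _ _ (ip y) (fun=> N y));
  [exact: inner_continuous|exact: cst_continuous].
Qed.

(** Directions in which the atom b can move to first order within the atoms ([tangent_atom]). With
    the line of b and W b they decompose the space orthogonally. *)
Definition tangent b g := ip b g = 0 /\ forall v, W b v -> ip v g = 0.

(** The subgradients b + v at b vanish on g, so N has slope 0 along g. Quantitatively, dual-ball
    vectors of slope at least d along g have value at most 1 - m at b, by compactness; for small t
    this loss outweighs their gain t N g. *)
Lemma tangent_norm b g d : atom b -> tangent b g -> 0 < d ->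
  exists2 t0, 0 < t0 & forall t, 0 < t < t0 -> N (b + t *: g) <= 1 + t * d.
Proof.
move=> atb [bg Wg] d0; have C0 := is_norm_ge0 hN g.
have [m m0 hm] : exists2 m, 0 < m & forall g', dual_ball g' -> d <= ip g g' ->
  ip g' b <= 1 - m.
  pose S := dual_ball `&` [set g' | d <= ip g g'].
  have [S0|no] := pselect (S !=set0); last first.
    by exists 1 => // g' h1 h2; case: no; exists g'.
  have [C hC] := dual_ball_bounded.
  have cf : continuous (fun g' => - ip b g') by exact/continuous_opp/inner_continuous.
  have [|g' [h1 /= h2] gmin] := mx_exists_min cf _ S0 (fun x Sx => hC x Sx.1).
    by apply: closedI; [exact: dual_ball_closed|exact: inner_ge_closed].
  exists (1 - ip b g').
    rewrite subr_gt0 lt_neqAle; apply/andP; split; last first.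
      by rewrite innerC // -(atom_N atb).
    apply/eqP => bg1; have [|Wv _] := atom_dec atb h1; first by rewrite innerC.
    have := Wg _ Wv; rewrite innerDl innerNl bg subr0 innerC // => h3.
    by move: h2; rewrite h3 leNgt d0.
  by move=> k hk dk; have := gmin k (conj hk dk); rewrite (innerC hB k); lra.
exists (m / (N g + 1)); first by rewrite divr_gt0 //; lra.
move=> t /andP[t0]; rewrite ltr_pdivlMr; last by lra.
move=> tm; have hk := @e_dual_ball (b + t *: g); rewrite -(e_inner (b + t *: g)).
rewrite innerDr // innerZr //.
have kb := hk b; have kg := hk g; rewrite (atom_N atb) in kb.
have [dk|dk] := leP d (ip g (e (b + t *: g))).
  have := hm _ hk dk; move: kg; nra.
rewrite (innerC hB _ g); nra.
Qed.

(** For x = b + t g, |x| >= 1 and N x <= 1 + t d / 3. The atom a maximising <x, .> has <x, a> >= 1 -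
    t d / 3, so the residual has N at most 2 t d / 3, and replacing <x, a> by 1 costs the last
    third. *)
Lemma tangent_atom b g d : atom b -> tangent b g -> 0 < d ->
  exists2 t0, 0 < t0 & forall t, 0 < t < t0 ->
    exists2 b', atom b' & norm2 B (b' - (b + t *: g)) <= d * t.
Proof.
move=> atb tg d0; have d3 : 0 < d / 3 by rewrite divr_gt0.
have [t0 t00 h] := tangent_norm atb tg d3.
exists t0 => // t tt; have Nx := h t tt; move: tt => /andP[tp _].
have xx : 1 <= ip (b + t *: g) (b + t *: g).
  rewrite !(innerE hB) (innerC hB g b) tg.1 atb.2; have := inner_ge0 hB g; nra.
move: (b + t *: g) Nx xx => x Nx xx.
have x0 : x != 0 by apply: contraTneq xx => ->; rewrite inner0l -ltNge.
have [a ata xa] := atom_max x; exists a => //.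
have [_ Nxa] := max_residual ata xa x0.
have h1 : 1 <= ip x a * N x by exact: le_trans xx (xa x).
have h2 : ip x a <= N x by rewrite innerC //; exact: atom_dual_ball.
have -> : a - x = (1 - ip x a) *: a - (x - ip x a *: a).
  by apply/colP => i; rewrite !mxE; lra.
apply: le_trans (norm2_triangle hB _ _) _; rewrite norm2N // norm2Z //.
have -> : norm2 B a = 1 by rewrite /norm2 ata.2 sqrtr1.
have := norm2_le_N (x - ip x a *: a).
have Nx0 := is_norm_gt0 hN x0.
have h3 : 1 - t * (d / 3) <= ip x a.
  have ga : 0 < ip x a by rewrite -(pmulr_lgt0 _ Nx0); lra.
  have : 1 <= ip x a * (1 + t * (d / 3)).
    by apply: le_trans h1 _; apply: ler_wpM2l Nx; exact: ltW.
  have td : 0 < t * (d / 3) by exact: mulr_gt0.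
  move: (t * (d / 3)) td => u; nra.
have : `|1 - ip x a| <= t * (d / 3) by rewrite ler_norml; apply/andP; split; lra.
lra.
Qed.

(** The face exposed by s contains s / <s, s>, because N s <= <s, s>; the minimisers of <l, .> on it
    form a face of the ball, which contains an atom. *)
Lemma tripotent_face_min s l : tripotent s -> 0 < ip s s ->
  exists y, [/\ atom y, ip s y = 1 & forall z, N z <= 1 -> 1 <= ip s z -> ip l
    y <= ip l z].
Proof.
move=> [hs Ns] s0; pose F := [set z | N z <= 1] `&` [set z | 1 <= ip s z].
have cF : closed F by apply: closedI; [exact: ball_closed|exact: inner_ge_closed].
have F0 : F !=set0.
  exists ((ip s s)^-1 *: s); split; rewrite /= ?innerZr // ?mulVf ?gt_eqF //.
  rewrite is_norm_pZ // ?invr_ge0 ?inner_ge0 //.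
  by rewrite mulrC ler_pdivrMr // mul1r.
have [C hC] := ball_bounded.
have [m Fm mmin] := mx_exists_min (inner_continuous hB (g := l)) cF F0 (fun x
  Fx => hC x Fx.1).
have sN z : N z <= 1 -> ip s z <= 1 by move=> Nz; exact: le_trans (hs z) Nz.
have [|||y1 y2 t N1 N2 /andP[t0 t1]|a [[[Na /= sa] /= la] ata _]] :=
  @face_atom (F `&` [set z | ip l z <= ip l m]).
- apply: closedI => //.
  apply: (@closed_le_fun _ _ (ip l) (fun=> ip l m));
    [exact: inner_continuous|exact: cst_continuous].
- by exists m; split => /=.
- by move=> y [[]].
- move=> [[_ /= h1] /= h2]; have s1 := sN _ N1; have s2 := sN _ N2.
  move: h1 h2; rewrite !(innerE hB) => h1 h2.
  have e1 : 1 <= ip s y1 by nra.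
  have e2 : 1 <= ip s y2 by nra.
  have l1 := mmin _ (conj N1 e1); have l2 := mmin _ (conj N2 e2).
  by split; do 2?split=> //=; nra.
exists a; split=> //; first by apply: le_anti; rewrite sa sN.
by move=> z Nz sz; apply: le_trans la _; apply: mmin.
Qed.

(** P y is the projection of y on T b minus its component along b. P comes from choice; the last
    clause is the self-adjointness that replaces linearity. *)
Lemma tangent_projection b : atom b -> exists P : 'cV[R]_n -> 'cV[R]_n,
  forall y, [/\ tangent b (P y), W b (y - ip b y *: b - P y) &
    forall z, ip (P y) z = ip (P y) (P z)].
Proof.
move=> atb.
suff H y : exists u, tangent b u /\ W b (y - ip b y *: b - u).
  have [P hP] := choice H; exists P => y; have [[tb tW] hy] := hP y.
  split=> // z; have [_ hz] := hP z.
  have : ip (P y) (z - ip b z *: b - P z) = 0 by rewrite innerC //; exact: tW.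
  rewrite !(innerE hB) (innerC hB (P y) b) tb; lra.
have [u uT uy] := orth_projection hB (T b) y.
have bT : b \in T b by rewrite -{1}(atom_e atb); exact: (hdec b).1.
have bu : ip b (y - u) = 0 by exact: uy.
exists (u - ip b y *: b); split; last first.
  by have -> : y - ip b y *: b - (u - ip b y *: b) = y - u
    by apply/colP => i; rewrite !mxE; lra.
split.
  by move: bu; rewrite !(innerE hB) atb.2; lra.
move=> v Wv; rewrite innerDr // innerNr // innerZr // (innerC hB v u) (Wv _ uT).
by rewrite (innerC hB v b) (Wv _ bT); lra.
Qed.

(** * Combinations of atoms and the maximin problem on a face *)

Lemma mulmx_col_sum (p : nat) (X : 'M[R]_(n, p)) (b : 'cV[R]_p) :
  X *m b = \sum_j b j 0 *: col j X.
Proof.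
apply/colP => i; rewrite mxE summxE; apply: eq_bigr => j _.
by rewrite !mxE mulrC.
Qed.

Lemma inner_suml (I : Type) (r : seq I) (F : I -> 'cV[R]_n) y :
  ip (\sum_(i <- r) F i) y = \sum_(i <- r) ip (F i) y.
Proof.
elim/big_rec2: _ => [|i x z _ <-]; first by rewrite inner0l.
by rewrite innerDl.
Qed.

Lemma inner_mulmx_col (p : nat) (X : 'M[R]_(n, p)) (b : 'cV[R]_p) y :
  ip (X *m b) y = \sum_j b j 0 * ip (col j X) y.
Proof.
by rewrite mulmx_col_sum inner_suml; apply: eq_bigr => j _; rewrite innerZl.
Qed.

Lemma norm2_sum_le (p : nat) (F : 'I_p -> 'cV[R]_n) :
  norm2 B (\sum_j F j) <= \sum_j norm2 B (F j).
Proof.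
elim/big_ind2: _ => [|a x b y ax yb|//]; first by rewrite norm2_0.
exact: le_trans (norm2_triangle hB _ _) (lerD ax yb).
Qed.

Lemma forall_ord_pos (p : nat) (P : 'I_p -> R -> Prop) :
  (forall j, exists2 t0, 0 < t0 & forall t, 0 < t < t0 -> P j t) ->
  exists2 t0, 0 < t0 & forall t, 0 < t < t0 -> forall j, P j t.
Proof.
move=> h; have h' j : exists t0, 0 < t0 /\ forall t, 0 < t < t0 -> P j t.
  by have [t0 ? ?] := h j; exists t0.
have [f hf] := choice h'; exists (\big[Num.min/1]_j f j).
  elim/big_ind: _ => // [a b a0 b0|j _]; first by rewrite lt_min a0.
  exact: (hf j).1.
move=> t /andP[t0 tf] j; apply: (hf j).2; rewrite t0; apply: lt_le_trans tf _.
exact: bigmin_le_cond.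
Qed.

Lemma col_continuous (p : nat) (j : 'I_p) : continuous (fun X : 'M[R]_(n, p) => col j X).
Proof.
move=> X A /nbhs_ballP[d /= d0 dA]; apply/nbhs_ballP; exists d => //= Y /= XY.
apply: dA; move: XY; rewrite !mx_norm_ball /ball_ /= -linearB; apply: le_lt_trans.
by apply: mx_norm_le => // i k; rewrite mxE; exact: ler_mx_norm.
Qed.

Lemma atom_columns_closed (p : nat) :
  closed [set X : 'M[R]_(n, p) | forall j, atom (col j X)].
Proof.
have -> : [set X : 'M[R]_(n, p) | forall j, atom (col j X)] =
    \bigcap_j ((fun X => col j X) @^-1` ([set x | N x <= 1] `&` [set x | 1 <= ip x x])).
  apply/seteqP; split=> [X hX j _|X hX j]; first by have [? ?] := hX j; split=> //=; lra.
  have [/= h1 h2] := hX j I; split=> //; apply: le_anti; rewrite h2 andbT.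
  have := inner_le_N (col j X); have := is_norm_ge0 hN (col j X); nra.
apply: closed_bigI => j _; apply: closed_comp; first by move=> X _; exact: col_continuous.
apply: closedI; first exact: ball_closed.
apply: (@closed_le_fun _ _ (fun=> 1) (fun x => ip x x)); [exact: cst_continuous|].
exact: inner_diag_continuous.
Qed.

Lemma atom_columns_bounded (p : nat) : exists C, forall X : 'M[R]_(n, p),
  (forall j, atom (col j X)) -> `|X| <= C.
Proof.
have [C hC] := ball_bounded; exists (Num.max 0 C) => X hX.
apply: mx_norm_le; first by rewrite le_max lexx.
move=> i j; rewrite le_max; apply/orP; right; apply: le_trans (hC _ (hX j).1).
by have := ler_mx_norm (col j X) i 0; rewrite mxE.
Qed.

Lemma mulmx_norm2_le (p : nat) (b : 'cV[R]_p) :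
  exists2 C, 0 < C & forall X : 'M[R]_(n, p), norm2 B (X *m b) <= C * `|X|.
Proof.
have [C C0 h] := is_norm_le_mx (norm2_is_norm hB).
exists (C * (1 + \sum_j `|b j 0|)).
  by rewrite mulr_gt0 // ltr_pwDl // sumr_ge0.
move=> X; apply: le_trans (h _) _; rewrite -mulrA; apply: ler_wpM2l; first exact: ltW.
apply: mx_norm_le; first by rewrite mulr_ge0 // addr_ge0 // sumr_ge0.
move=> i k; rewrite mxE; apply: le_trans (ler_norm_sum _ _ _) _.
rewrite mulrDl mul1r mulr_suml -[leLHS]add0r lerD // ler_sum // => j _.
by rewrite normrM mulrC ord1 ler_wpM2l // ler_mx_norm.
Qed.

(* First-order condition at a choice of atoms maximising
   min_{y in face} <X b, y>: some minimiser y has no component tangent to the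
   atoms; otherwise moving the atoms along the tangent components of the
   minimiser with the smallest ones increases the minimum. *)
Lemma maximin_stationary p (X : 'M[R]_(n, p)) (b : 'cV[R]_p) s mu :
  (forall j, atom (col j X)) -> (forall j, 0 <= b j 0) ->
  (forall y, N y <= 1 -> 1 <= ip s y -> mu <= ip (X *m b) y) ->
  (forall X' : 'M[R]_(n, p), (forall j, atom (col j X')) ->
     exists y, [/\ N y <= 1, 1 <= ip s y & ip (X' *m b) y <= mu]) ->
  exists y, [/\ N y <= 1, 1 <= ip s y, ip (X *m b) y = mu &
    forall j, 0 < b j 0 -> W (col j X) (y - ip (col j X) y *: col j X)].
Proof.
move=> atX b0 mumin mumax; set x := X *m b in mumin *.
have [P hP] := choice (fun j => tangent_projection (atX j)).
(* Moving each atom along P j y by t changes X b by t Pi y to first order; <Pi y, y> is the weighted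
   sum of the |P j y|^2. *)
pose Pi y := \sum_j b j 0 *: P j y.
have PiE y z : ip (Pi y) z = \sum_j b j 0 * ip (P j y) (P j z).
  rewrite inner_suml; apply: eq_bigr => j _; rewrite innerZl.
  by have [_ _ ->] := hP j y.
have PiC y z : ip (Pi y) z = ip (Pi z) y.
  by rewrite !PiE; apply: eq_bigr => j _; rewrite innerC.
have Pi_ge0 y : 0 <= ip (Pi y) y.
  by rewrite PiE sumr_ge0 // => j _; rewrite mulr_ge0 // inner_ge0.
have Pi_cont : continuous (fun y => ip (Pi y) y).
  have -> : (fun y => ip (Pi y) y) =
      (fun y => \sum_i y i 0 * ip (Pi (delta_mx i 0)) y).
    apply/funext => y; rewrite {2}(matrix_sum_delta y) innerC // inner_suml.
    by apply: eq_bigr => i _; rewrite big_ord1 innerZl innerC // PiC.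
  apply: continuous_sum => i; apply: continuous_mul; first exact: coord_continuous.
  exact: inner_continuous.
(* Y is the set of minimisers of <x, .> on the face; y is chosen in it with least <Pi y, y>. *)
pose Y := ([set z | N z <= 1] `&` [set z | 1 <= ip s z]) `&` [set z | ip x z <= mu].
have cF : closed ([set z | N z <= 1] `&` [set z | 1 <= ip s z]).
  by apply: closedI; [exact: ball_closed|exact: inner_ge_closed].
have le_closed g c : closed [set z | ip g z <= c].
  by apply: (@closed_le_fun _ _ (ip g) (fun=> c));
    [exact: inner_continuous|exact: cst_continuous].
have cY : closed Y by exact: closedI.
have Y0 : Y !=set0 by have [y [h1 h2 h3]] := mumax X atX; exists y.
have [C hC] := ball_bounded.
have [y [[/= Ny sy] /= xy] ymin] := mx_exists_min Pi_cont cY Y0 (fun z Yz => hC z Yz.1.1).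
have {}xy : ip x y = mu by apply: le_anti; rewrite xy mumin.
exists y; split=> // j bj.
have [Pi0|Pi1] := eqVneq (ip (Pi y) y) 0.
  suff Py0 : P j y = 0 by have [_ + _] := hP j y; rewrite Py0 subr0.
  apply: (inner_eq0 hB); move/eqP: Pi0; rewrite PiE psumr_eq0; last first.
    by move=> k _; rewrite mulr_ge0 // inner_ge0.
  move/allP/(_ j); rewrite mem_index_enum => /(_ isT)/=.
  by rewrite mulf_eq0 gt_eqF //= => /eqP.
exfalso.
have sig0 : 0 < ip (Pi y) y by rewrite lt_neqAle eq_sym Pi1 Pi_ge0.
set sig := ip (Pi y) y in sig0.
(* First-order optimality of y for the quadratic form <Pi z, z> on the convex set Y. *)
have Dsig z : Y z -> sig <= ip (Pi y) z.
  move=> [[/= Nz sz] /= xz].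
  have line t : 0 < t <= 1 -> 0 <= 2 * (ip (Pi y) z - sig) + t * ip (Pi (z - y)) (z - y).
    move=> /andP[t0 t1].
    have Yt : Y (t *: z + (1 - t) *: y).
      have t01 : 0 <= t <= 1 by rewrite ltW.
      split; [split|] => /=.
      - apply: le_trans (N_convex z y t01) _; nra.
      - rewrite !(innerE hB); nra.
      - rewrite !(innerE hB) xy; nra.
    have := ymin _ Yt.
    have -> : t *: z + (1 - t) *: y = y + t *: (z - y).
      by apply/colP => i; rewrite !mxE; ring.
    have -> : ip (Pi (y + t *: (z - y))) (y + t *: (z - y)) =
        sig + t * (2 * (ip (Pi y) z - sig) + t * ip (Pi (z - y)) (z - y)).
      rewrite innerDr // innerZr // !(PiC (y + _)) !innerDr // !innerZr //.
      by rewrite (PiC (z - y) y) !innerDr // innerNr // -/sig; ring.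
    by rewrite -/sig lerDl pmulr_rge0.
  rewrite leNgt; apply/negP => lt.
  set q := ip (Pi (z - y)) (z - y) in line.
  have q0 : 0 <= q by exact: Pi_ge0.
  pose t := Num.min 1 ((sig - ip (Pi y) z) / (q + 1)).
  have q1 : 0 < q + 1 by lra.
  have t0 : 0 < t by rewrite lt_min ltr01 divr_gt0 // subr_gt0.
  have t1 : t <= 1 by rewrite ge_min lexx.
  have tq : t * (q + 1) <= sig - ip (Pi y) z by rewrite -ler_pdivlMr // ge_min lexx orbT.
  have := line t; rewrite t0 t1 => /(_ isT); nra.
set D := Pi y in Dsig.
(* By [Dsig] this part of the face contains no minimiser, so by compactness <x, .> exceeds mu there
   by a fixed eta. *)
pose F2 := ([set z | N z <= 1] `&` [set z | 1 <= ip s z]) `&` [set z | ip D z <= sig / 2].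
have [eta eta0 heta] : exists2 eta, 0 < eta & forall z, F2 z -> mu + eta <= ip x z.
  have [F20|no] := pselect (F2 !=set0); last first.
    by exists 1 => // z Fz; case: no; exists z.
  have [|z Fz zmin] := mx_exists_min (inner_continuous hB (g := x)) _ F20 (fun
    z Fz => hC z Fz.1.1).
    exact: closedI.
  exists (ip x z - mu); last by move=> w Fw; have := zmin _ Fw; lra.
  rewrite subr_gt0 ltNge; apply/negP => xz.
  have := Dsig z (conj Fz.1 xz); have : ip D z <= sig / 2 := Fz.2; lra.
pose bs := \sum_j b j 0.
have bs0 : 0 <= bs by rewrite sumr_ge0.
(* Tolerance per atom such that replacing the moved columns by true atoms costs at most t sig / 4 in
   all. *)
pose d := sig / (4 * (bs + 1)).
have d0 : 0 < d by rewrite divr_gt0 // mulr_gt0 //; lra.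
have dbs : d * bs <= sig / 4.
  have dE : d * (bs + 1) = sig / 4 by rewrite /d; field; lra.
  nra.
have tg j' : tangent (col j' X) (P j' y) by have [] := hP j' y.
have [t0 t00 ht0] := forall_ord_pos (fun j' => tangent_atom (atX j') (tg j') d0).
have ND : 0 <= norm2 B D by exact: norm2_ge0.
pose t1 := eta / (norm2 B D + sig + 1).
have t10 : 0 < t1 by rewrite divr_gt0 //; lra.
pose t := Num.min t0 t1 / 2.
have mt : 0 < Num.min t0 t1 by rewrite lt_min t00.
have tp : 0 < t by rewrite divr_gt0.
have tlt0 : t < t0.
  have : Num.min t0 t1 <= t0 by rewrite ge_min lexx.
  rewrite /t; lra.
have tlt1 : t * (norm2 B D + sig + 1) < eta.
  rewrite -ltr_pdivlMr; last by lra.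
  have : Num.min t0 t1 <= t1 by rewrite ge_min lexx orbT.
  rewrite -/t1 /t; lra.
have ht j' : exists b', atom b' /\ norm2 B (b' - (col j' X + t *: P j' y)) <= d * t.
  by have [|b' ? ?] := ht0 t _ j'; [rewrite tp|exists b'].
have [f hf] := choice ht.
pose X' := \matrix_(i, k) f k i 0.
have colX' k : col k X' = f k by apply/colP => i; rewrite !mxE.
have atX' k : atom (col k X') by rewrite colX'; exact: (hf k).1.
have [w [Nw sw xw]] := mumax X' atX'.
have wn : norm2 B w <= 1 by exact: le_trans (norm2_le_N w) Nw.
have err : `|ip (X' *m b - (x + t *: D)) w| <= t * sig / 4.
  apply: le_trans (normr_inner_le hB _ _) _.
  have le1 : norm2 B (X' *m b - (x + t *: D)) <= t * sig / 4.
    have -> : X' *m b - (x + t *: D) =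
        \sum_k b k 0 *: (f k - (col k X + t *: P k y)).
      rewrite /x /D /Pi !mulmx_col_sum scaler_sumr -big_split -sumrB /=.
      apply: eq_bigr => k _; rewrite colX' scalerBr scalerDr.
      by rewrite !scalerA (mulrC t).
    apply: le_trans (norm2_sum_le _) _.
    apply: (@le_trans _ _ (\sum_k b k 0 * (d * t))).
      apply: ler_sum => k _; rewrite norm2Z // ger0_norm //.
      by rewrite ler_wpM2l //; exact: (hf k).2.
    rewrite -mulr_suml -/bs; nra.
  have := norm2_ge0 B w; have := norm2_ge0 B (X' *m b - (x + t *: D)); nra.
have Dw : - norm2 B D <= ip D w.
  have := normr_inner_le hB D w; rewrite ler_norml => /andP[h _]; nra.
have ipE : ip (X' *m b) w = ip (X' *m b - (x + t *: D)) w + ip x w + t * ip D w.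
  by rewrite !innerDl innerNl innerDl innerZl; ring.
move: err; rewrite ler_norml => /andP[err _].
(* On F2 the gain eta outweighs the loss t (|D| + sig / 4); off F2 the gain t sig / 2 outweighs t
   sig / 4. Either way the value at w exceeds mu. *)
have [Dle|Dlt] := leP (ip D w) (sig / 2).
  have := heta w (conj (conj Nw sw) Dle); nra.
have := mumin w Nw sw; nra.
Qed.

(** The minimum over the face is 1-Lipschitz in the functional, hence continuous in X, and the
    matrices of atoms form a compact set. The last clause transfers an upper bound on mu back to the
    given X. *)
Lemma exists_maximin p (X : 'M[R]_(n, p)) (b : 'cV[R]_p) s :
  tripotent s -> 0 < ip s s -> (forall j, atom (col j X)) ->
  exists (X0 : 'M[R]_(n, p)) mu, [/\ forall j, atom (col j X0),
    forall y, N y <= 1 -> 1 <= ip s y -> mu <= ip (X0 *m b) y,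
    forall X' : 'M[R]_(n, p), (forall j, atom (col j X')) ->
      exists y, [/\ N y <= 1, 1 <= ip s y & ip (X' *m b) y <= mu] &
    exists y, [/\ atom y, ip s y = 1 & ip (X *m b) y <= mu]].
Proof.
move=> ts s0 atX.
have [Y hY] := choice (fun l => tripotent_face_min l ts s0).
have F_Y l : N (Y l) <= 1 /\ 1 <= ip s (Y l).
  by have [[NY _] sY _] := hY l; rewrite sY.
pose m l := ip l (Y l).
have mle l l' : m l' - m l <= norm2 B (l' - l).
  have [_ _ /(_ (Y l) (F_Y l).1 (F_Y l).2) h] := hY l'.
  have := inner_le hB (l' - l) (Y l); rewrite innerDl innerNl /m.
  have := le_trans (norm2_le_N (Y l)) (F_Y l).1.
  have := norm2_ge0 B (l' - l); nra.
have [C C0 hC] := mulmx_norm2_le b.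
have cm : continuous (fun X : 'M[R]_(n, p) => - m (X *m b)).
  move=> Z A /nbhs_ballP[d /= d0 dA]; apply/nbhs_ballP; exists (d / C).
    by rewrite /= divr_gt0.
  move=> Z'; rewrite mx_norm_ball /ball_ /= => ZZ; apply: dA; rewrite /ball /=.
  have CZ : C * `|Z - Z'| < d by rewrite mulrC -ltr_pdivlMr.
  have CZ' : C * `|Z' - Z| < d by rewrite distrC.
  have h1 := hC (Z - Z'); have h2 := hC (Z' - Z); rewrite !mulmxBl in h1 h2.
  have := mle (Z *m b) (Z' *m b); have := mle (Z' *m b) (Z *m b).
  by move=> h3 h4; rewrite ltr_norml; apply/andP; split; lra.
have [D hD] := @atom_columns_bounded p.
have [X0 atX0 X0min] := mx_exists_min cm (@atom_columns_closed p) (ex_intro _ X atX) hD.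
exists X0, (m (X0 *m b)); split=> //.
- by move=> y Ny sy; have [_ _] := hY (X0 *m b); apply.
- move=> X' atX'; exists (Y (X' *m b)); split; [exact: (F_Y _).1|exact: (F_Y _).2|].
  by have := X0min X' atX'; rewrite lerN2.
- exists (Y (X *m b)); have [a1 a2 _] := hY (X *m b); split=> //.
  by have := X0min X atX; rewrite lerN2.
Qed.

(* At a maximiser of the minimum over the face, a stationary minimiser forces
   one of the atoms into the face; it is split off s and the others are handled
   by induction. *)
Lemma tripotent_face_inner_le0 p (X : 'M[R]_(n, p)) (b : 'cV[R]_p) s :
  tripotent s -> p%:R < ip s s -> (forall j, atom (col j X)) ->
  (forall j, 0 <= b j 0) ->
  exists y, [/\ atom y, ip s y = 1 & ip (X *m b) y <= 0].
Proof.
elim: p X b s => [|p IH] X b s ts ps atX b0.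
  have [y [aty sy _]] := tripotent_face_min 0 ts ps.
  by exists y; split=> //; rewrite inner_mulmx_col big_ord0.
have s0 : 0 < ip s s by apply: le_lt_trans ps.
have [X0 [mu [atX0 mumin mumax [y [aty sy ymu]]]]] := exists_maximin b ts s0 atX.
exists y; split=> //; apply: le_trans ymu _; rewrite leNgt; apply/negP => mu0.
have [w [Nw sw xw Ww]] := maximin_stationary atX0 b0 mumin mumax.
have [j bj] : exists j, 0 < b j 0 * ip (col j X0) w.
  apply: contrapT => no; move: mu0; rewrite -xw inner_mulmx_col ltNge => /negP; apply.
  by apply: sumr_le0 => j _; rewrite leNgt; apply/negP => h; apply: no; exists j.
have bj0 : 0 < b j 0.
  by rewrite lt_neqAle b0 andbT eq_sym; apply: contraTneq bj => ->; rewrite mul0r ltxx.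
have al0 : 0 < ip (col j X0) w by rewrite -(pmulr_rgt0 _ bj0).
have {}Ww := Ww j bj0; have atj := atX0 j.
set a := col j X0 in atj al0 Ww.
have [t [Wt ht tw]] := orth_aligned Ww.
(* With q = w - <a, w> a, evaluating a + t at w gives <a, w> + N q <= 1 <= <s, w> <= <a, w> <s, a> +
   N q, so <s, a> >= 1. *)
have sa : ip s a = 1.
  apply: le_anti; rewrite -{1}(atom_N atj) ts.1 /=.
  have h1 := atom_add atj Wt ht w.
  have h2 := ts.1 (w - ip a w *: a).
  have h3 : ip t a = 0 by rewrite innerC // (atom_orth atj Wt).
  move: tw h1 h2; rewrite !(innerE hB) h3 => tw h1 h2.
  have : ip a w * 1 <= ip a w * ip s a by lra.
  by rewrite ler_pM2l.
have [_ tsa saa] := tripotent_sub ts atj sa.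
(* The point y' obtained for s - a lies on the face of s and is orthogonal to a; hence <X0 b, y'> <=
   0 < mu, against [mumin]. *)
have [|k|k|y' [aty' sy' xy']] := IH (col' j X0) (row' j b) (s - a) tsa.
- by rewrite saa; move: ps; rewrite -natr1; lra.
- have -> : col k (col' j X0) = col (lift j k) X0 by apply/colP => i; rewrite !mxE.
  exact: atX0.
- by rewrite mxE.
have [|ay' sy''] := face_sub ts.1 atj sa (y := y'); first by rewrite sy' atom_N.
have := mumin y' aty'.1; rewrite sy'' (atom_N aty') lexx => /(_ isT).
rewrite leNgt => /negP; apply; apply: le_lt_trans mu0.
move: xy'; rewrite !inner_mulmx_col (bigD1_ord j) //= -/a ay' mulr0 add0r.
apply: le_trans; rewrite le_eqVlt; apply/orP; left; apply/eqP.
apply: eq_bigr => k _; rewrite mxE; congr (_ * ip _ _).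
by apply/colP => i; rewrite !mxE.
Qed.

(** * Subadditivity of the rank and tripotents below e x *)

Lemma rank_sub_le x y : N (x - y) ^+ 2 <= (Kof B e x + Kof B e y) * norm2 B (x - y) ^+ 2.
Proof.
have [s [p [fx _]]] := frame_exists x; have [t [q [fy _]]] := frame_exists y.
have [u [k [fh _]]] := frame_exists (x - y).
have Kx z s' p' : frame z s' p' -> Kof B e z = p'%:R.
  by move=> fz; rewrite /Kof norm2_sqr // -(frame_e fz) (frame_inner fz).
rewrite (Kx _ _ _ fx) (Kx _ _ _ fy) -natrD.
have kpq : (k <= p + q)%N.
  (* Negated atoms are atoms, so x - y is a nonnegative combination of p + q atoms, yet it is
     positive on the face exposed by its own frame sum u. *)
  rewrite leqNgt; apply/negP => pqk.
  have [X [b [atX b0 xE]]] := frame_atoms fx; have [Y [c [atY c0 yE]]] := frame_atoms fy.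
  have [|j|j|w [atw uw xw]] := @tripotent_face_inner_le0 (p + q) (row_mx X (- Y))
      (col_mx b c) u (frame_tripotent fh).
  - by rewrite (frame_inner fh) ltr_nat.
  - case: (split_ordP j) => i ->; rewrite ?colKl ?colKr //.
    have [N1 I1] := atY i; have -> : col i (- Y) = - col i Y by apply/colP => l;
      rewrite !mxE.
    by split; [rewrite (is_normN hN)|rewrite innerNl (innerNr hB) opprK].
  - by case: (split_ordP j) => i ->; rewrite ?col_mxEu ?col_mxEd.
  have := face_atom_inner_gt0 fh atw uw; rewrite xE yE ltNge => /negP; apply.
  by move: xw; rewrite mul_row_col mulNmx.
have kpq' : (k%:R : R) <= (p + q)%:R by rewrite ler_nat.
apply: (@le_trans _ _ (k%:R * norm2 B (x - y) ^+ 2)); last first.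
  by rewrite ler_wpM2r // sqr_ge0.
rewrite (frame_norm fh) -(frame_inner fh) norm2_sqr //; exact: inner_sqr_le.
Qed.

Lemma Kof_inner x : Kof B e x = ip (e x) (e x).
Proof. exact: norm2_sqr. Qed.

(** As long as s has rank above that of x, its face has an atom a with <x, a> <= 0; the search
    continues in s - a, whose face lies in that of s. The clause on W keeps later atoms orthogonal
    to a. *)
Lemma sub_tripotent x (m : nat) s : tripotent s -> Kof B e x + m%:R <= ip s s ->
  exists u, [/\ dual_ball u, N u <= m%:R, ip u u = m%:R, ip s u = m%:R & ip x u <= 0] /\
    ((forall z, (forall y, atom y -> ip s y = 1 -> 0 <= ip z y) -> 0 <= ip z u) /\
     (forall y, W y s -> W y u)).
Proof.
have [t [p [fx _]]] := frame_exists x.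
have [X [b [atX b0 xE]]] := frame_atoms fx.
rewrite Kof_inner -(frame_e fx) (frame_inner fx) {t fx}.
elim: m s => [|m IH] s ts sm.
  exists 0; rewrite !inner0r //; do 2?split=> //.
  - exact: dual_ball0.
  - by rewrite is_norm0.
  - by move=> z _; rewrite inner0r.
  - by move=> y _; exact: orth0.
have [|a [ata sa xa]] := tripotent_face_inner_le0 (X := X) (b := b) ts _ atX b0.
  by move: sm; rewrite -natr1; have := ler0n R m; lra.
have [Wv tv vv] := tripotent_sub ts ata sa.
have [|u [[hu Nu uu su xu] [posu Wu]]] := IH (s - a) tv.
  by move: sm; rewrite vv -natr1; lra.
have Wau := Wu _ Wv; have au := atom_orth ata Wau.
have s0 : s != 0.
  by apply: contra_eq_neq sa => ->; rewrite inner0l eq_sym oner_eq0.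
exists (a + u); do 2?split.
- exact: atom_add.
- by apply: le_trans (is_norm_triangle hN _ _) _; rewrite (atom_N ata) -natr1; lra.
- by rewrite !(innerE hB) (innerC hB u a) au uu ata.2 -natr1; lra.
- move: su; rewrite !(innerE hB) au sa -natr1; lra.
- by move: xa; rewrite -xE !(innerE hB); lra.
- move=> z hz; rewrite innerDr // addr_ge0 //; first exact: hz.
  apply: posu => y aty vy; apply: hz => //.
  have [|_ ->] := face_sub ts.1 ata sa (y := y); first by rewrite vy atom_N.
  exact: atom_N.
- move=> y Wy; have Wya : W y a.
    apply: (orth_max Wy s0 ata) => z; rewrite sa mul1r; exact: ts.1.
  by apply: orthD => //; apply: Wu; apply: orthD => //; exact: orthN.
Qed.

(** Take u below e x and g = e x + v. Since e x + v and e x - v are in the dual ball and e x already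
    attains N u at u, <v, u> = 0: every subgradient has the same value m at u. *)
Lemma sub_tripotent_e x0 x (m : nat) g : subdiff B N x g -> Kof B e x0 + m%:R
  <= Kof B e x ->
  exists u, [/\ dual_ball u, N u = m%:R, ip u u = m%:R, ip g u = m%:R &
    ip x0 u <= 0 /\ 0 <= ip x u].
Proof.
move=> /subdiffP[hg gx]; rewrite [in leRHS]Kof_inner => Km.
have [u [[hu Nu uu su xu] [posu Wu]]] := sub_tripotent (e_tripotent x) Km.
have [v [Wv hv gE]] := decP hg gx.
have vu : ip v u = 0.
  have [h1 _] := decP_inv Wv hv; have [h2 _] := decP_inv (orthN Wv) (dual_ballN hv).
  have := h1 u; have := h2 u; rewrite !(innerE hB) su; lra.
exists u; split=> //; last split=> //.
- by apply: le_anti; rewrite Nu -su e_dual_ball.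
- by rewrite gE innerDl su vu addr0.
- apply: posu => y aty; have [s [p [fx _]]] := frame_exists x.
  by rewrite -(frame_e fx) => sy; apply/ltW/(face_atom_inner_gt0 fx).
Qed.

(** * Estimates around x0 *)

Lemma norm_growth x0 h u : u \in T x0 -> W x0 (h - u) ->
  N x0 + N (h - u) - N u <= N (x0 + h).
Proof.
(* The subgradient e x0 + s is tested at x0 + h: s recovers N (h - u), and e x0 loses at most N
   u. *)
move=> uT Wh; have [s [Ws hs sh]] := orth_aligned Wh.
have [hg gx] := decP_inv Ws hs; have := hg (x0 + h); rewrite innerDr // gx.
have : ip (e x0 + s) h = ip (e x0) u + N (h - u).
  rewrite -{1}(subrK u h); have := e_orth Wh; move: (h - u) sh => w sw ew.
  by rewrite innerDr // !innerDl sw ew (innerC hB s) (Ws _ uT); lra.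
move=> ->; have := dual_ballN (@e_dual_ball x0) u; rewrite innerNl; lra.
Qed.

Lemma norm2_projection_le x0 h u : u \in T x0 -> W x0 (h - u) -> ip u u <= ip h h.
Proof.
move=> uT /(_ _ uT); rewrite -[in ip h h](subrK u h); move: (h - u) => v uv.
by rewrite !innerDl !innerDr // (innerC hB v u) uv; have := inner_ge0 hB v; lra.
Qed.

Lemma Kof_ge1 x : x != 0 -> 1 <= Kof B e x.
Proof.
move=> x0; have := e_inner x; have := inner_le hB (e x) x.
have := norm2_le_N x; have := is_norm_gt0 hN x0; rewrite /Kof.
have := norm2_ge0 B (e x) => h0 h1 h2 h3 h4.
have : 1 <= norm2 B (e x) by rewrite -(ler_pM2r h1) mul1r; nra.
nra.
Qed.

Lemma cconst_le x0 u : x0 != 0 -> u \in T x0 ->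
  N u ^+ 2 <= cconst B N (T x0) (Kof B e x0) * Kof B e x0 * ip u u.
Proof.
move=> x00 uT; move: (Kof B e x0) (Kof_ge1 x00) => k K1.
have [->|u0] := eqVneq u 0; first by rewrite is_norm0 // inner0l mulr0 expr0n.
have uu := hB.2 _ u0; have k0 : 0 < k by lra.
rewrite -mulrA -ler_pdivrMr ?mulr_gt0 //.
apply: ub_le_sup; last by exists u => //; rewrite norm2_sqr.
have [C C0 hC] := N_le_norm2; exists (C ^+ 2) => _ [y [_ y0] <-].
have yy := hB.2 _ y0; rewrite norm2_sqr // ler_pdivrMr ?mulr_gt0 //.
have : N y ^+ 2 <= (C * norm2 B y) ^+ 2.
  by rewrite ler_sqr ?nnegrE ?mulr_ge0 ?norm2_ge0 ?is_norm_ge0 // ltW.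
rewrite exprMn norm2_sqr // => h; apply: le_trans h _.
apply: ler_wpM2l; first exact: sqr_ge0.
by rewrite -[leLHS]mul1r ler_wpM2r // ltW.
Qed.

(** At e x0, which lies in T x0 and has N (e x0) = |e x0|^2 = k0, the quotient equals 1. *)
Lemma cconst_ge1 x0 : x0 != 0 -> 1 <= cconst B N (T x0) (Kof B e x0).
Proof.
move=> x00; have K1 := Kof_ge1 x00.
have := cconst_le x00 (hdec x0).1; rewrite (tripotent_norm (e_tripotent x0)) -Kof_inner.
set k := Kof B e x0 in K1 *; move=> h.
have k0 : 0 < k * k by rewrite mulr_gt0 //; lra.
by rewrite -(ler_pM2r k0); lra.
Qed.

Lemma exists_atom : exists a, atom a.
Proof. by have [a ata _] := atom_max 0; exists a. Qed.

End Geometry.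

(** * Least squares, restricted constants and the prox map *)

Section LeastSquares.
Variables (R : realType) (m n : nat) (B : 'M[R]_n) (N : 'cV[R]_n -> R)
  (A : 'M[R]_(m, n)) (b : 'cV[R]_m).
Hypotheses (hB : sym_posdef B) (hN : is_norm N)
  (hext : forall a, extreme_point [set y | N y <= 1] a -> norm2 B a = 1).
Local Notation ip := (inner B).
Local Notation dot := (inner (1%:M : 'M[R]_m)).
Local Notation gr := (grad B A b).
Local Notation pr := (prox B N A b).
Implicit Types x y z h p g : 'cV[R]_n.

Lemma sym_posdef1 (k : nat) : sym_posdef (1%:M : 'M[R]_k).
Proof.
split=> [|x x0]; first exact: trmx1.
rewrite /inner mulmx1 mxE lt_neqAle; apply/andP; split; last first.
  by apply: sumr_ge0 => i _; rewrite mxE -expr2 sqr_ge0.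
apply: contra x0; rewrite eq_sym psumr_eq0 => [/allP h|i _]; last first.
  by rewrite mxE -expr2 sqr_ge0.
apply/eqP/colP => i; have := h i; rewrite mem_index_enum => /(_ isT) /=.
by rewrite !mxE mulf_eq0 orbb => /eqP.
Qed.

Lemma enorm_sqr (y : 'cV[R]_m) : enorm y ^+ 2 = dot y y.
Proof. exact/norm2_sqr/sym_posdef1. Qed.

Lemma sym_posdef_unit : B \in unitmx.
Proof.
rewrite -row_free_unit -kermx_eq0; apply/eqP/row_matrixP => i.
rewrite row0; apply: trmx_inj; rewrite trmx0; apply/eqP/negPn/negP => /hB.2.
rewrite /inner trmxK.
have -> : row i (kermx B) *m B = 0.
  by apply/sub_kermxP; exact: row_sub.
by rewrite mul0mx mxE ltxx.
Qed.

Lemma inner_adj (u : 'cV[R]_m) x : ip (adj B A *m u) x = dot u (A *m x).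
Proof.
rewrite /inner /adj !trmx_mul trmxK trmx_inv hB.1 mulmx1.
by rewrite -!mulmxA mulKmx ?sym_posdef_unit // mulmxA.
Qed.

Lemma grad_sub x y : gr y - gr x = adj B A *m (A *m (y - x)).
Proof.
rewrite /grad -mulmxBr [A *m (y - x)]mulmxBr; congr (_ *m _).
by move: (A *m y) (A *m x) => u v; apply/colP => i; rewrite !mxE; ring.
Qed.

Lemma fls_expand x y : fls A b y =
  fls A b x + ip (gr x) (y - x) + 2^-1 * enorm (A *m (y - x)) ^+ 2.
Proof.
rewrite /fls /grad inner_adj !enorm_sqr.
have -> : A *m y - b = (A *m x - b) + A *m (y - x).
  rewrite mulmxBr; move: (A *m y) (A *m x) => u v.
  by apply/colP => i; rewrite !mxE; ring.
have h1 := sym_posdef1 m; move: (A *m x - b) (A *m (y - x)) => u v.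
by rewrite !(innerE h1) (innerC h1 v u); field.
Qed.

Lemma enorm_mulZ t h : enorm (A *m (t *: h)) ^+ 2 = t ^+ 2 * enorm (A *m h) ^+ 2.
Proof.
by rewrite !enorm_sqr -scalemxAr !(innerE (sym_posdef1 m)); ring.
Qed.

(** Makes the set whose infimum is [rho_plus] nonempty. *)
Lemma enorm_mul_le : exists2 C, 0 < C & forall h, enorm (A *m h) ^+ 2 <= C *
  norm2 B h ^+ 2.
Proof.
have h1 := sym_posdef1 m.
have [C C0 hC] := is_norm_le_mx (norm2_is_norm h1).
have [D D0 hD] := mx_le_is_norm (norm2_is_norm hB).
pose a := 1 + \sum_i \sum_j `|A i j|.
have a0 : 0 < a by rewrite ltr_pwDl // sumr_ge0 // => i _; rewrite sumr_ge0.
have hA h : `|A *m h| <= a * `|h|.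
  apply: mx_norm_le; first by rewrite mulr_ge0 // ltW.
  move=> i k; rewrite mxE; apply: le_trans (ler_norm_sum _ _ _) _.
  apply: (@le_trans _ _ ((\sum_j `|A i j|) * `|h|)).
    rewrite mulr_suml; apply: ler_sum => j _; rewrite normrM ler_wpM2l //.
    exact: ler_mx_norm.
  rewrite ler_wpM2r // /a (bigD1 i) //= addrCA lerDl.
  by rewrite addr_ge0 // sumr_ge0 // => j _; rewrite sumr_ge0.
exists ((C * a * D) ^+ 2); first by rewrite exprn_gt0 // !mulr_gt0.
move=> h; rewrite -exprMn ler_sqr ?nnegrE ?norm2_ge0 //; last first.
  by rewrite mulr_ge0 ?norm2_ge0 // ltW // !mulr_gt0.
apply: le_trans (hC _) _; rewrite -!mulrA; apply: ler_wpM2l; first exact: ltW.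
apply: le_trans (hA h) _; apply: ler_wpM2l; first exact: ltW.
exact: hD.
Qed.

Lemma rho_plus_ge0 k : 0 <= rho_plus B N A k.
Proof.
apply: lb_le_inf; last by move=> s [].
have [C C0 hC] := enorm_mul_le; exists C; split; [exact: ltW|by move=> x _; exact: hC].
Qed.

Lemma rho_plusP k h : N h ^+ 2 <= k * norm2 B h ^+ 2 ->
  enorm (A *m h) ^+ 2 <= rho_plus B N A k * norm2 B h ^+ 2.
Proof.
move=> hk; have [->|h0] := eqVneq h 0.
  by rewrite mulmx0 enorm_sqr inner0l mulr_ge0 ?rho_plus_ge0 ?sqr_ge0.
have nh : 0 < norm2 B h ^+ 2 by rewrite exprn_gt0 // norm2_gt0.
rewrite -ler_pdivrMr //; apply: lb_le_inf.
  by have [C C0 hC] := enorm_mul_le; exists C; split; [exact: ltW|move=> x _; exact: hC].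
by move=> s [_ hs]; rewrite ler_pdivrMr //; exact: hs.
Qed.

Lemma atom_rho k a : 1 <= k -> atom B N a -> N a ^+ 2 <= k * norm2 B a ^+ 2.
Proof.
move=> k1 ata; rewrite (atom_N hB hN hext ata) norm2_sqr // ata.2 expr1n; lra.
Qed.

Lemma rho_minusP k h : 1 <= k -> N h ^+ 2 <= k * norm2 B h ^+ 2 ->
  rho_minus B N A k * norm2 B h ^+ 2 <= enorm (A *m h) ^+ 2.
Proof.
move=> k1 hk; have [->|h0] := eqVneq h 0.
  by rewrite norm2_0 expr0n mulr0 sqr_ge0.
have nh : 0 < norm2 B h ^+ 2 by rewrite exprn_gt0 // norm2_gt0.
rewrite -ler_pdivlMr //; apply: ge_sup.
  by exists 0; split=> // x _; rewrite mul0r sqr_ge0.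
by move=> s [_ hs]; rewrite ler_pdivlMr //; exact: hs.
Qed.

Lemma rho_minus_le_plus k : 1 <= k -> rho_minus B N A k <= rho_plus B N A k.
Proof.
move=> k1; have [a ata] := exists_atom hB hN hext; have ak := atom_rho k1 ata.
have := le_trans (rho_minusP k1 ak) (rho_plusP ak).
by rewrite norm2_sqr // ata.2 !mulr1.
Qed.

(** Common first-order condition for minimisers of Phi and of the model: a linear term that absorbs
    an O(t^2) error for all small t is nonnegative. *)
Lemma subdiff_of_min lam p g (C : 'cV[R]_n -> R) : 0 < lam ->
  (forall y t, 0 < t <= 1 ->
    0 <= t * (ip g (y - p) + lam * (N y - N p)) + t ^+ 2 * C y) ->
  subdiff B N p (- lam^-1 *: g).
Proof.
move=> l0 h y; rewrite innerZl.
suff : 0 <= ip g (y - p) + lam * (N y - N p).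
  move=> h1; have : 0 <= lam^-1 * (ip g (y - p) + lam * (N y - N p)).
    by rewrite mulr_ge0 // invr_ge0 ltW.
  by rewrite mulrDr mulKf ?gt_eqF //; lra.
rewrite leNgt; apply/negP; set D := ip g (y - p) + _ => D0.
pose q := `|C y| + 1; have q1 : 0 < q by rewrite ltr_wpDl.
(* For this t the quadratic term offsets at most half of t D. *)
pose t := Num.min 1 (- D / q / 2).
have Dq : 0 < - D / q / 2 by rewrite !divr_gt0 // oppr_gt0.
have t0 : 0 < t by rewrite lt_min ltr01.
have t1 : t <= 1 by rewrite ge_min lexx.
have tq : t * q <= - D / 2.
  have : t <= - D / q / 2 by rewrite ge_min lexx orbT.
  by rewrite -(ler_pM2r q1) mulrAC mulfVK ?gt_eqF.
have := h y t; rewrite t0 t1 => /(_ isT); rewrite -/D expr2 -mulrA -mulrDr pmulr_rge0 //.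
have : t * C y <= t * q by rewrite ler_pM2l // /q; have := ler_norm (C y); lra.
lra.
Qed.

Lemma convex_step t y p : 0 < t <= 1 -> N (p + t *: (y - p)) <= N p + t * (N y - N p).
Proof.
move=> /andP[t0 t1].
have -> : p + t *: (y - p) = t *: y + (1 - t) *: p by apply/colP => i; rewrite !mxE; ring.
have t01 : 0 <= t <= 1 by rewrite ltW.
by apply: le_trans (N_convex hN y p t01) _; lra.
Qed.

Lemma argmin_subdiff lam p : 0 < lam -> argmin (phi N A b lam) p ->
  subdiff B N p (- lam^-1 *: gr p).
Proof.
move=> l0 pmin;
  apply: (@subdiff_of_min _ _ _ (fun y => 2^-1 * enorm (A *m (y - p)) ^+ 2)) => //.
move=> y t tt; have := pmin (p + t *: (y - p)).
have E : p + t *: (y - p) - p = t *: (y - p) by rewrite addrC addKr.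
rewrite /phi (fls_expand p (p + _)) E innerZr // enorm_mulZ.
have := convex_step y p tt; rewrite -(ler_pM2l l0); lra.
Qed.

Lemma mmodel_expand lam L y p x : mmodel B N A b lam L y x =
  mmodel B N A b lam L y p + ip (gr y + L *: (p - y)) (x - p)
  + L / 2 * norm2 B (x - p) ^+ 2 + lam * (N x - N p).
Proof.
rewrite /mmodel; have -> : x - y = (x - p) + (p - y) by rewrite addrA subrK.
rewrite !norm2_sqr //; move: (x - p) (p - y) => u v.
by rewrite !(innerE hB) (innerC hB v u); field.
Qed.

Lemma mmodel_continuous lam L y : continuous (mmodel B N A b lam L y).
Proof.
have -> : mmodel B N A b lam L y = (fun x => (mmodel B N A b lam L y 0 - lam * N 0)
    + (ip (gr y - L *: y) x + (L / 2 * ip x x + lam * N x))).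
  apply/funext => x; rewrite (mmodel_expand _ _ y 0 x) norm2_sqr // subr0 sub0r scalerN.
  ring.
have cc (c : R) : continuous (fun _ : 'cV[R]_n => c) by exact: cst_continuous.
apply: continuous_add => //; apply: continuous_add; first exact: inner_continuous.
apply: continuous_add.
  by apply: (@continuous_mul _ _ (fun=> L / 2) (fun x => ip x x)) => //;
    exact: inner_diag_continuous.
by apply: (@continuous_mul _ _ (fun=> lam) N) => //; exact: is_norm_continuous.
Qed.

Lemma prox_argmin lam L y : 0 < L -> 0 <= lam ->
  argmin (mmodel B N A b lam L y) (prox B N A b lam L y).
Proof.
move=> L0 l0; rewrite /prox; case: xgetP => [p -> //|no]; exfalso.
have mc := @mmodel_continuous lam L y.
pose S := [set x | mmodel B N A b lam L y x <= mmodel B N A b lam L y y].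
have [D D0 hD] := mx_le_is_norm (norm2_is_norm hB).
(* Below the level of y and at distance d > 1 from y, the model gives L/2 d^2 <= (|grad| + lam N y)
   d; the summand 1 covers d <= 1. *)
pose r := 1 + 2 * (norm2 B (gr y) + lam * N y) / L.
have c0 : 0 <= norm2 B (gr y) + lam * N y.
  by rewrite addr_ge0 ?norm2_ge0 // mulr_ge0 // is_norm_ge0.
have r1 : 1 <= r by rewrite lerDl; apply: divr_ge0; [exact: mulr_ge0|exact: ltW].
have bS x : S x -> `|x| <= D * (norm2 B y + r).
  move=> Sx; apply: le_trans (hD x) _; apply: ler_wpM2l; first exact: ltW.
  rewrite -{1}(subrKC y x); apply: le_trans (norm2_triangle hB _ _) _; rewrite lerD2l.
  move: Sx; rewrite /S /= (mmodel_expand _ _ y y x) subrr scaler0 addr0.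
  set d := norm2 B (x - y) => h.
  have d0 : 0 <= d by exact: norm2_ge0.
  have h2 : - (norm2 B (gr y) * d) <= ip (gr y) (x - y).
    by have := normr_inner_le hB (gr y) (x - y); rewrite ler_norml => /andP[].
  have Nx : 0 <= lam * N x by rewrite mulr_ge0 // is_norm_ge0.
  have lN : 0 <= lam * N y by rewrite mulr_ge0 // is_norm_ge0.
  have [d1|d1] := leP d 1; first exact: le_trans d1 r1.
  have h3 : L / 2 * d ^+ 2 <= (norm2 B (gr y) + lam * N y) * d by nra.
  have h4 : d * L <= 2 * (norm2 B (gr y) + lam * N y).
    have d00 : 0 < d by lra.
    by rewrite -(ler_pM2r d00); lra.
  by rewrite /r -ler_pdivlMr // in h4 *; lra.
have cS : closed S.
  apply: (@closed_le_fun _ _ (mmodel B N A b lam L y) (fun=> _)) => //.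
  exact: cst_continuous.
have [x Sx xmin] := mx_exists_min mc cS (ex_intro _ y (lexx _)) bS.
apply: (no x) => z; have [Sz|nz] := pselect (S z); first exact: xmin.
by apply: le_trans Sx _; move/negP: nz; rewrite -ltNge => /ltW.
Qed.

Lemma prox_subdiff lam L y : 0 < L -> 0 < lam ->
  subdiff B N (pr lam L y) (- lam^-1 *: (gr y + L *: (pr lam L y - y))).
Proof.
move=> L0 l0; set p := pr lam L y; have pmin : argmin _ p := prox_argmin y L0 (ltW l0).
apply: (@subdiff_of_min _ _ _ (fun x => L / 2 * norm2 B (x - p) ^+ 2)) => //.
move=> x t tt; have := pmin (p + t *: (x - p)).
have E : p + t *: (x - p) - p = t *: (x - p) by rewrite addrC addKr.
rewrite (mmodel_expand lam L y p (p + _)) E innerZr //.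
rewrite !norm2_sqr // !innerZl // !innerZr //.
have := convex_step x p tt; rewrite -(ler_pM2l l0); lra.
Qed.

Lemma prox_growth lam L y x : 0 < L -> 0 < lam ->
  mmodel B N A b lam L y (pr lam L y) + L / 2 * norm2 B (x - pr lam L y) ^+ 2 <=
  mmodel B N A b lam L y x.
Proof.
move=> L0 l0; set p := pr lam L y; have := prox_subdiff y L0 l0 x.
rewrite (mmodel_expand lam L y p x) -/p innerZl -(ler_pM2l l0) mulrDr mulrA mulrN.
by rewrite mulfV ?gt_eqF //; lra.
Qed.

Lemma phi_mmodel lam L y x : phi N A b lam x = mmodel B N A b lam L y x
  + 2^-1 * (enorm (A *m (x - y)) ^+ 2 - L * norm2 B (x - y) ^+ 2).
Proof. by rewrite /phi /mmodel (fls_expand y x); field. Qed.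

Lemma mmodel_diag lam L y : mmodel B N A b lam L y y = phi N A b lam y.
Proof. by rewrite /mmodel /phi subrr inner0r // norm2_0 expr0n /= mulr0 !addr0. Qed.

(** Stands in for a minimising subgradient; the slack d is sent to 0 where it is used. *)
Lemma omega_adherent lam x D : subdiff B N x !=set0 -> omega B N A b lam x <= D ->
  forall d, 0 < d -> exists2 g, subdiff B N x g & dual_norm B N (lam *: g + gr
    x) <= D + d.
Proof.
move=> [g0 hg0] oD d d0.
have [|_ [g hg <-] h] := @inf_adherent _ [set dual_norm B N (lam *: xi + grad B A b x) |
    xi in subdiff B N x] d d0.
  split; first by exists (dual_norm B N (lam *: g0 + gr x)), g0.
  by exists 0 => _ [xi _ <-]; exact: dual_norm_ge0.
exists g => //; apply: ltW; apply: lt_le_trans h _; rewrite lerD2r; exact: oD.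
Qed.

Lemma omega_le lam x g : subdiff B N x g ->
  omega B N A b lam x <= dual_norm B N (lam *: g + gr x).
Proof.
move=> hg; apply: ge_inf; last by exists g.
by exists 0 => _ [xi _ <-]; exact: dual_norm_ge0.
Qed.

End LeastSquares.

(** * Error bounds relative to x0 *)

Section Recovery.
Variables (R : realType) (m n : nat) (B : 'M[R]_n) (N : 'cV[R]_n -> R)
  (T : 'cV[R]_n -> {vspace 'cV[R]_n}) (e : 'cV[R]_n -> 'cV[R]_n)
  (A : 'M[R]_(m, n)) (x0 : 'cV[R]_n) (z : 'cV[R]_m)
  (ginc ltgt r delta lam : R).
Hypotheses (hB : sym_posdef B) (hN : is_norm N)
  (hext : forall a, extreme_point [set y | N y <= 1] a -> norm2 B a = 1)
  (hdec : decomposable B N T e) (hx0 : x0 != 0).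
Local Notation ip := (inner B).
Local Notation dot := (inner (1%:M : 'M[R]_m)).
Local Notation W := (orth B (T x0)).
Local Notation b := (A *m x0 + z).
Local Notation zeta := (dual_norm B N (adj B A *m z)).
Local Notation Phi := (phi N A b lam).
Local Notation om := (omega B N A b lam).
Local Notation gr := (grad B A b).
Local Notation Q h := (enorm (A *m h) ^+ 2).
Local Notation k0 := (Kof B e x0).
Local Notation c := (cconst B N (T x0) k0).
Implicit Types x y h u p g : 'cV[R]_n.

Lemma inner_grad x v : ip (gr x) v = dot (A *m (x - x0)) (A *m v) - ip (adj B A *m z) v.
Proof.
rewrite /grad !(inner_adj _ hB); have h1 := sym_posdef1 R m.
have -> : A *m x - b = A *m (x - x0) - z.
  by rewrite mulmxBr; move: (A *m x) (A *m x0) => u w; apply/colP => i;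
    rewrite !mxE; ring.
by rewrite innerDl innerNl.
Qed.

Lemma noise_le h : `|ip (adj B A *m z) h| <= zeta * N h.
Proof.
rewrite ler_norml (inner_le_dual hB hN hext) andbT lerNl -(innerNr hB) -(is_normN hN).
exact: inner_le_dual.
Qed.

Lemma zeta_ge0 : 0 <= zeta. Proof. exact: dual_norm_ge0. Qed.

Lemma subdiff_e x : subdiff B N x (e x).
Proof.
by apply/(subdiffP hB hN); split;
  [exact: (e_dual_ball hB hN hext hdec)|exact: (e_inner hB hN hext hdec)].
Qed.

Lemma phi_convex_le x y D : 0 < lam -> om x <= D -> Phi x - Phi y <= D * N (x - y).
Proof.
move=> l0 oD; apply/ler_addgt0Pr => d d0.
have Nd : 0 < N (x - y) + 1 by have := is_norm_ge0 hN (x - y); lra.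
have [|g hg gD] := omega_adherent hB hN hext _ oD (divr_gt0 d0 Nd).
  by exists (e x); exact: subdiff_e.
have h1 : ip (lam *: g + gr x) (x - y) <= (D + d / (N (x - y) + 1)) * N (x - y).
  apply: le_trans (inner_le_dual hB hN hext _ _) _.
  by rewrite ler_wpM2r // is_norm_ge0.
have h2 : d / (N (x - y) + 1) * N (x - y) <= d.
  rewrite -{2}(divfK (lt0r_neq0 Nd) d); apply: ler_wpM2l; last by lra.
  by rewrite divr_ge0 // ltW.
have h3 := hg y.
have h4 : lam * (N x + ip g (y - x)) <= lam * N y by rewrite ler_pM2l.
have h5 := sqr_ge0 (enorm (A *m (y - x))).
rewrite /phi (fls_expand A b hB x y).
move: h1 h2 h4; rewrite !(innerE hB) => h1 h2 h4; lra.
Qed.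

(** A nearly optimal subgradient is paired with h = x - x0: <g, h> >= N x - N x0 >= N (h - u) - N u,
    and the gradient contributes Q h up to noise. *)
Lemma cone_inequality x u D : 0 < lam -> om x <= D -> u \in T x0 -> W (x - x0 - u) ->
  Q (x - x0) + (lam - zeta - D) * N (x - x0 - u) <= (lam + zeta + D) * N u.
Proof.
move=> l0 oD uT Wu; apply/ler_addgt0Pr => d d0.
set h := x - x0 in Wu *.
have Nu := is_norm_ge0 hN u; have Nw := is_norm_ge0 hN (h - u).
have Nh : N h <= N u + N (h - u).
  by rewrite -{1}(subrKC u h); exact: is_norm_triangle.
have Nd : 0 < N h + 1 by have := is_norm_ge0 hN h; lra.
have [|g hg gD] := omega_adherent hB hN hext _ oD (divr_gt0 d0 Nd).
  by exists (e x); exact: subdiff_e.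
have h1 : ip (lam *: g + gr x) h <= (D + d / (N h + 1)) * N h.
  apply: le_trans (inner_le_dual hB hN hext _ _) _.
  by rewrite ler_wpM2r // is_norm_ge0.
have h2 : d / (N h + 1) * N h <= d.
  rewrite -{2}(divfK (lt0r_neq0 Nd) d); apply: ler_wpM2l; last by lra.
  by rewrite divr_ge0 // ltW.
have D0 : 0 <= D.
  by apply: le_trans oD; apply: lb_le_inf => [|_ [xi _ <-]];
    [exists (dual_norm B N (lam *: e x + gr x)), (e x) => //;
      exact: subdiff_e|exact: dual_norm_ge0].
have h3 : N u * -1 + N (h - u) <= ip g h.
  have := hg x0; have := norm_growth hB hN hext hdec uT Wu.
  have -> : x0 + h = x by rewrite /h addrC subrK.
  have -> : x0 - x = - h by rewrite /h opprB.
  rewrite innerNr //; lra.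
have h4 : lam * (N u * -1 + N (h - u)) <= lam * ip g h by rewrite ler_pM2l.
have h5 : ip (gr x) h = Q h - ip (adj B A *m z) h by rewrite inner_grad enorm_sqr.
have h6 := noise_le h; rewrite ler_norml in h6; have /andP[_ {}h6] := h6.
have h7 : (zeta + D) * N h <= (zeta + D) * (N u + N (h - u)).
  by apply: ler_wpM2l => //; rewrite addr_ge0 // zeta_ge0.
move: h1; rewrite innerDl innerZl h5; lra.
Qed.

Lemma level_inequality x u D : 0 < lam -> Phi x <= Phi x0 + D -> u \in T x0 ->
  W (x - x0 - u) ->
  2^-1 * Q (x - x0) + (lam - zeta) * N (x - x0 - u) <= (lam + zeta) * N u + D.
Proof.
move=> l0; rewrite /phi (fls_expand A b hB x0 x) inner_grad subrr mulmx0
  inner0l => xD uT Wu.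
set h := x - x0 in xD Wu *.
have Nh : N h <= N u + N (h - u).
  by rewrite -{1}(subrKC u h); exact: is_norm_triangle.
have h6 := noise_le h; rewrite ler_norml in h6; have /andP[_ {}h6] := h6.
have := norm_growth hB hN hext hdec uT Wu.
have -> : x0 + h = x by rewrite /h addrC subrK.
rewrite -(ler_pM2l l0) => h3.
have h7 : zeta * N h <= zeta * (N u + N (h - u)) by apply: ler_wpM2l => //;
  exact: zeta_ge0.
lra.
Qed.

Hypotheses (hginc : 1 < ginc) (hltgt : 0 < ltgt) (hr : 1 < r)
  (hdelta : 0 < delta <= 1 / 4) (hlam : ltgt <= lam).
Local Notation gamma := (gamma_of B N A z ltgt delta).
Local Notation k1 := (c * k0 * (1 + gamma) ^+ 2).
Local Notation kt := (36 * r * c * k0 * (1 + gamma) * ginc).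
Hypothesis hA : assumptionA B N A z k0 c ginc ltgt r delta.

Lemma lam_gt0 : 0 < lam. Proof. exact: lt_le_trans hltgt hlam. Qed.

Lemma zeta_le : zeta <= lam / 4.
Proof. by have [h _ _] := hA; have := hlam; lra. Qed.

(** With delta <= 1/4 and noise at most ltgt / 4, the quotient is at most (3/2) / (1/2). The last
    inequality is the definition of gamma carried from ltgt to lam, using gamma (1 - delta) >= 1 +
    delta. *)
Lemma gamma_bounds : [/\ 1 <= gamma, gamma <= 3 &
  lam * (1 + delta) + zeta <= gamma * (lam * (1 - delta) - zeta)].
Proof.
have [zl _ _] := hA; have z0 := zeta_ge0; move/andP: hdelta => [d0 d4].
have lt0 := hltgt; have ll := hlam.
have ld : 0 < delta * ltgt <= ltgt / 4 by apply/andP; split; nra.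
have [ld0 ld4] := andP ld.
have den : 0 < ltgt * (1 - delta) - zeta by lra.
have gE : gamma * (ltgt * (1 - delta) - zeta) = ltgt * (1 + delta) + zeta.
  by rewrite /gamma_of divfK // gt_eqF.
have g1 : 1 <= gamma by rewrite /gamma_of ler_pdivlMr // mul1r; lra.
have g3 : gamma <= 3 by rewrite /gamma_of ler_pdivrMr //; lra.
split=> //; move: gE g1; move: (gamma) => g gE g1.
have h1 : 1 + delta <= g * (1 - delta).
  by rewrite -(ler_pM2l lt0); nra.
nra.
Qed.

Lemma k0_ge1 : 1 <= k0. Proof. exact: (Kof_ge1 hB hN hext hdec). Qed.
Lemma c_ge1 : 1 <= c. Proof. exact: (cconst_ge1 hB hN hext hdec). Qed.

Lemma kt_ge1 : 1 <= kt.
Proof.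
have [g1 _ _] := gamma_bounds; have c1 := c_ge1; have kk := k0_ge1.
have h1 : 1 <= r * c by rewrite mulr_ege1 // ltW.
have h2 : 1 <= r * c * k0 by rewrite mulr_ege1.
have g2 : 1 <= 1 + gamma by lra.
have h3 : 1 <= r * c * k0 * (1 + gamma) by rewrite mulr_ege1.
have h4 : 1 <= r * c * k0 * (1 + gamma) * ginc by rewrite mulr_ege1 // ltW.
rewrite -!mulrA in h4 *; lra.
Qed.

Local Notation rp := (rho_plus B N A (2 * kt)).
Local Notation rm := (rho_minus B N A (2 * kt)).
Local Notation rho1 := (rho_minus B N A k1).

Lemma two_kt_ge1 : 1 <= 2 * kt. Proof. by have := kt_ge1; lra. Qed.

Lemma rho_facts : [/\ 0 < rm, 0 < rp, 0 < rho1 & c * rp < r * rho1].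
Proof.
have [_ + +] := hA.
have -> : 72 * r * c * k0 * (1 + gamma) * ginc = 2 * kt by ring.
move=> h1 h2; have c1 := c_ge1; have r0 : 0 < r by have := hr; lra.
have rp0 : 0 < rp by apply: lt_le_trans h2 _;
  exact: (rho_minus_le_plus A hB hN hext two_kt_ge1).
have h : c * rp < r * rho1.
  by move: h1; rewrite ltr_pdivrMr // mulrAC ltr_pdivlMr // (mulrC rho1).
split=> //; rewrite -(pmulr_rgt0 _ r0); apply: le_lt_trans h.
by apply: mulr_ge0; [lra|exact: ltW].
Qed.

Local Notation Theta1 := (c * k0 * lam ^+ 2 / rho1).
Local Notation Theta := ((1 + gamma) * Theta1).

Lemma Theta1_gt0 : 0 < Theta1.
Proof.
have [_ _ h _] := rho_facts; have c1 := c_ge1; have kk := k0_ge1; have l0 := lam_gt0.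
have c0 : 0 < c by lra.
have k00 : 0 < k0 by lra.
exact: divr_gt0 (mulr_gt0 (mulr_gt0 c0 k00) (exprn_gt0 2 l0)) h.
Qed.

(** On the cone N h <= (1 + gamma) N u, which is the sparsity level k1, so |u|^2 <= |h|^2 <= Q h /
    rho1; [Theta1] collects the constants. *)
Lemma cone_sqr h u : u \in T x0 -> W (h - u) -> N (h - u) <= gamma * N u ->
  (lam * N u) ^+ 2 <= Theta1 * Q h.
Proof.
move=> uT Wu hu; have [rm0 rp0 r10 _] := rho_facts; have [g1 _ _] := gamma_bounds.
have c1 := c_ge1; have kk := k0_ge1.
have Nu := cconst_le hB hN hext hdec hx0 uT.
have uh := norm2_projection_le hB uT Wu.
have {}Nu : N u ^+ 2 <= c * k0 * norm2 B h ^+ 2.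
  apply: le_trans Nu _; rewrite norm2_sqr //; apply: ler_wpM2l => //.
  by rewrite mulr_ge0 //; lra.
have Nh : N h <= (1 + gamma) * N u.
  by rewrite -{1}(subrKC u h); apply: le_trans (is_norm_triangle hN _ _) _; lra.
have k11 : 1 <= k1.
  by rewrite mulr_ege1 //; [rewrite mulr_ege1|rewrite exprn_ege1 //; lra].
have Nh2 : N h ^+ 2 <= k1 * norm2 B h ^+ 2.
  apply: (@le_trans _ _ ((1 + gamma) ^+ 2 * N u ^+ 2)).
    rewrite -exprMn ler_sqr ?nnegrE ?is_norm_ge0 //.
    by rewrite mulr_ge0 ?is_norm_ge0 //; lra.
  have -> : k1 * norm2 B h ^+ 2 = (1 + gamma) ^+ 2 * (c * k0 * norm2 B h ^+ 2) by ring.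
  by apply: ler_wpM2l => //; exact: sqr_ge0.
have hq := rho_minusP A hB k11 Nh2.
rewrite exprMn.
have -> : Theta1 * Q h = lam ^+ 2 * (c * k0 * (Q h / rho1)) by ring.
apply: ler_wpM2l; first exact: sqr_ge0.
apply: le_trans Nu _; apply: ler_wpM2l; first by rewrite mulr_ge0 //; lra.
by rewrite ler_pdivlMr // mulrC.
Qed.

(** [gamma] is chosen so that om x <= delta lam puts x - x0 in the cone. There Q h <= (3/2) lam N u,
    since lam + zeta + delta lam <= (3/2) lam; with [cone_sqr], lam N u <= (3/2) Theta1, and
    convexity bounds the gap. *)
Lemma init_gap x : om x <= delta * lam -> Phi x - Phi x0 <= 3 / 2 * delta * Theta.
Proof.
move=> ox; have l0 := lam_gt0; have [u uT Wu] := orth_projection hB (T x0) (x - x0).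
have := cone_inequality l0 ox uT Wu; have [g1 g3 gl] := gamma_bounds.
have := zeta_le; have z0 := zeta_ge0; move/andP: hdelta => [d0 d4].
set h := x - x0 in Wu *; have Nu := is_norm_ge0 hN u; have Nw := is_norm_ge0 hN (h - u).
have Q0 : 0 <= Q h by exact: sqr_ge0.
have dl : 0 < delta * lam <= lam / 4 by apply/andP; split; nra.
have [dl0 dl4] := andP dl.
move=> zl hc.
have cone : N (h - u) <= gamma * N u.
  have den : 0 < lam - zeta - delta * lam by lra.
  rewrite -(ler_pM2l den).
  have : (lam + zeta + delta * lam) * N u <= gamma * (lam - zeta - delta * lam) * N u.
    by apply: ler_wpM2r => //; lra.
  lra.
have sq := cone_sqr uT Wu cone.
have Q1 : Q h <= 3 / 2 * (lam * N u).
  have : (lam + zeta + delta * lam) * N u <= (3 / 2 * lam) * N u.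
    by apply: ler_wpM2r => //; lra.
  have : 0 <= (lam - zeta - delta * lam) * N (h - u) by rewrite mulr_ge0 //; lra.
  lra.
have T0 := Theta1_gt0.
have lu : lam * N u <= 3 / 2 * Theta1.
  move: sq Q1 T0 (mulr_ge0 (ltW l0) Nu);
    move: (Theta1) (Q h) (lam * N u) => t q s sq Q1 T0 s0.
  rewrite leNgt; apply/negP => ts.
  have : t * q <= t * (3 / 2 * s) by rewrite ler_pM2l.
  nra.
apply: le_trans (phi_convex_le x0 l0 ox) _.
have Nh : N h <= (1 + gamma) * N u.
  by rewrite -{1}(subrKC u h); apply: le_trans (is_norm_triangle hN _ _) _; lra.
rewrite -/h; apply: (@le_trans _ _ (delta * lam * ((1 + gamma) * N u))).
  by rewrite ler_pM2l.
have -> : delta * lam * ((1 + gamma) * N u) = delta * (1 + gamma) * (lam * N u) by ring.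
have -> : 3 / 2 * delta * Theta = delta * (1 + gamma) * (3 / 2 * Theta1) by ring.
by apply: ler_wpM2l => //; rewrite mulr_ge0 //; lra.
Qed.

(* Off the cone, the slack of gamma over (lam + zeta) / (lam - zeta) is
   proportional to delta, and so is the excess of Phi: delta cancels. *)
Lemma error_bounds x : Phi x <= Phi x0 + 3 / 2 * delta * Theta ->
  lam * N (x - x0) <= 3 * Theta /\ Q (x - x0) <= 5 * Theta.
Proof.
move=> xD; have l0 := lam_gt0; have [u uT Wu] := orth_projection hB (T x0) (x - x0).
have := level_inequality l0 xD uT Wu; have [g1 g3 gl] := gamma_bounds.
have zl := zeta_le; have z0 := zeta_ge0; move/andP: hdelta => [d0 d4].
set h := x - x0 in Wu *; have Nu := is_norm_ge0 hN u; have Nw := is_norm_ge0 hN (h - u).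
have Q0 : 0 <= Q h by exact: sqr_ge0.
have T0 := Theta1_gt0.
have T2 : Theta1 <= Theta / 2.
  have : 2 * Theta1 <= Theta by rewrite ler_wpM2r //; [exact: ltW|lra].
  lra.
have Tg : 0 < Theta by lra.
have Nh : N h <= N u + N (h - u).
  by rewrite -{1}(subrKC u h); exact: is_norm_triangle.
have lNh : lam * N h <= lam * N u + lam * N (h - u).
  by rewrite -mulrDr ler_pM2l.
have lu := mulr_ge0 (ltW l0) Nu; have lw := mulr_ge0 (ltW l0) Nw.
have dT : delta * Theta <= Theta / 4 by nra.
move=> hl.
have [cone|ncone] := leP (N (h - u)) (gamma * N u).
  have sq := cone_sqr uT Wu cone.
  have hl' : 2^-1 * Q h + 3 / 4 * (lam * N (h - u)) <= 5 / 4 * (lam * N u) + 3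
    / 8 * Theta.
    have : zeta * N u <= lam / 4 * N u by exact: ler_wpM2r.
    have : zeta * N (h - u) <= lam / 4 * N (h - u) by exact: ler_wpM2r.
    lra.
  have sq' : (lam * N u) ^+ 2 <= Theta / 2 * Q h.
    by apply: le_trans sq _; exact: ler_wpM2r.
  move: lNh hl' sq' Tg lu lw Q0.
  move: (lam * N h) (lam * N u) (lam * N (h - u)) (Theta) (Q h) => hh t w th q
    hh1 hl' sq' th0 t0 w0 q0.
  have q1 : q <= 5 / 2 * t + 3 / 4 * th by lra.
  (* In units of th, 3/2 is the positive root of t^2 = (5/4) t + 3/8. *)
  have t1 : t <= 3 / 2 * th.
    rewrite leNgt; apply/negP => lt.
    have : th / 2 * q <= th / 2 * (5 / 2 * t + 3 / 4 * th) by rewrite ler_pM2l //; lra.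
    nra.
  split; last by lra.
  apply: le_trans hh1 _.
  have : 3 / 4 * (t + w) * th <= (2 * t + 3 / 8 * th - 2^-1 * q) * th.
    by rewrite ler_pM2r //; lra.
  move=> h1; rewrite -(ler_pM2r th0); nra.
have gap : lam * delta * N (h - u) <= 3 / 2 * delta * Theta /\ 2^-1 * Q h <= 3
  / 2 * delta * Theta.
  have key : (lam + zeta) * N u <= (lam - zeta) * N (h - u) - lam * delta * N (h - u).
    have h1 : gamma * ((lam + zeta) * N u) <= (lam + zeta) * N (h - u).
      have : (lam + zeta) * (gamma * N u) <= (lam + zeta) * N (h - u).
        by apply: ler_wpM2l; [lra|exact: ltW].
      lra.
    have h2 : (lam + zeta) * N (h - u) <= (gamma * (lam - zeta) - lam * delta *
      (1 + gamma)) * N (h - u).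
      by apply: ler_wpM2r => //; lra.
    have gpos : 0 < gamma by lra.
    rewrite -(ler_pM2l gpos); apply: le_trans h1 _; apply: le_trans h2 _.
    have : 0 <= lam * delta * N (h - u) by rewrite !mulr_ge0 // ltW.
    lra.
  have : 0 <= lam * delta * N (h - u) by rewrite !mulr_ge0 // ltW.
  by split; lra.
have [gap1 gap2] := gap.
have w1 : lam * N (h - u) <= 3 / 2 * Theta.
  by rewrite -(ler_pM2l d0); lra.
split; last by lra.
have : lam * N u <= lam * N (h - u).
  rewrite ler_pM2l //; apply: le_trans (ltW ncone).
  by rewrite -[leLHS]mul1r ler_wpM2r.
lra.
Qed.

Local Notation rank0 := (r * k0 * (1 + gamma) * ginc).

(** The ratio condition enters here, as c rp / rho1 <= r: it converts the error level Theta into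
    rank units. *)
Lemma rp_Theta_le : ginc * (rp * Theta) <= rank0 * lam ^+ 2.
Proof.
have [rm0 rp0 r10 h] := rho_facts; have [g1 _ _] := gamma_bounds; have kk := k0_ge1.
have gi := hginc.
have -> : ginc * (rp * Theta) = ginc * (1 + gamma) * k0 * lam ^+ 2 * (c * rp /
  rho1) by ring.
have -> : rank0 * lam ^+ 2 = ginc * (1 + gamma) * k0 * lam ^+ 2 * r by ring.
apply: ler_wpM2l.
  by apply: mulr_ge0 (sqr_ge0 _); apply: mulr_ge0; [apply: mulr_ge0|]; lra.
by rewrite ler_pdivrMr // ltW.
Qed.

Lemma rank0_bounds : 2 * k0 <= rank0 /\ 36 * rank0 <= kt.
Proof.
have [g1 _ _] := gamma_bounds; have kk := k0_ge1; have c1 := c_ge1; have gi := hginc.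
have rr := hr.
have h1 : k0 <= r * k0 by rewrite -[leLHS]mul1r ler_wpM2r //; lra.
have h2 : 2 * k0 <= r * k0 * (1 + gamma).
  by rewrite mulrC; apply: ler_pM => //; lra.
have h3 : r * k0 * (1 + gamma) <= rank0 by rewrite -[leLHS]mulr1 ler_wpM2l //; lra.
split; first by lra.
have -> : kt = 36 * (c * rank0) by ring.
have : rank0 <= c * rank0 by rewrite -[leLHS]mul1r ler_wpM2r //; lra.
lra.
Qed.

(* If the rank of p were larger than kt, e p would contain a tripotent u of
   rank mm in ]20 rank0, 21 rank0] with <x0, u> <= 0; testing the optimality of
   p against u bounds mm. No bound on L * |p - x| is needed, because
   <p, u> >= 0. *)
Lemma prox_rank_le x p L : lam * N (x - x0) <= 3 * Theta -> Q (x - x0) <= 5 * Theta ->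
  0 <= L <= ginc * rp -> subdiff B N p (- lam^-1 *: (gr x + L *: (p - x))) ->
  Kof B e p <= kt.
Proof.
move=> Nx Qx /andP[L0 Lle] hp; rewrite leNgt; apply/negP => ktK.
have [h1 h2] := rank0_bounds; have kk := k0_ge1; have rT := rp_Theta_le.
have [rm0 rp0 _ _] := rho_facts; have l0 := lam_gt0; have gi := hginc.
have zl := zeta_le; have z0 := zeta_ge0.
have T1 := Theta1_gt0; have [g1 _ _] := gamma_bounds.
have T0 : 0 < Theta by apply: mulr_gt0 => //; lra.
set q := rank0 in h1 h2 rT; have q2 : 2 <= q by lra.
(* 20 q is what makes 5 q mm <= (mm / 2)^2 in the Cauchy-Schwarz bound [d2]; rounding up costs at
   most 1 <= q. *)
have /andP[m1 m2] := Num.Theory.truncn_itv (x := 20 * q) (ltac:(lra)).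
set mm := (Num.truncn (20 * q)).+1 in m2.
have m3 : mm%:R <= 21 * q by rewrite /mm -natr1; lra.
have Km : k0 + mm%:R <= Kof B e p by lra.
have [u [hu Nu uu gu [x0u pu]]] := sub_tripotent_e hB hN hext hdec hp Km.
move: gu; rewrite innerZl => gu.
have gu' : - ip (gr x + L *: (p - x)) u = lam * mm%:R.
  by rewrite -gu mulrA mulrN mulfV ?mulN1r // gt_eqF.
have Qu : Q u <= rp * mm%:R.
  rewrite -uu -norm2_sqr //; apply: (rho_plusP A hB).
  rewrite norm2_sqr // uu Nu expr2; apply: ler_wpM2r; first exact: ler0n.
  by lra.
have Lx : L * ip x u <= L * N (x - x0).
  apply: ler_wpM2l => //; have := hu (x - x0); rewrite innerC // innerDl innerNl; lra.
have Lp : 0 <= L * ip p u by exact: mulr_ge0.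
have nz := noise_le u; rewrite ler_norml Nu in nz; have /andP[_ {}nz] := nz.
have cs := inner_sqr_le (sym_posdef1 R m) (A *m (x - x0)) (A *m u).
rewrite -!enorm_sqr in cs.
set d := dot (A *m (x - x0)) (A *m u) in cs.
have key : lam * mm%:R <= - d + zeta * mm%:R + L * N (x - x0).
  by move: gu'; rewrite innerDl innerZl innerDl innerNl inner_grad -/d; lra.
have mp : 0 < (mm%:R : R) by lra.
have LN : lam * (L * N (x - x0)) <= 3 * (q * lam ^+ 2).
  apply: (@le_trans _ _ (ginc * rp * (3 * Theta))); last by lra.
  by rewrite mulrCA; apply: ler_pM => //; rewrite mulr_ge0 ?is_norm_ge0 ?(ltW l0).
have d2 : (lam * d) ^+ 2 <= (lam ^+ 2 * (mm%:R / 2)) ^+ 2.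
  have QQ : Q (x - x0) * Q u <= 5 * Theta * (rp * mm%:R).
    by apply: ler_pM => //; exact: sqr_ge0.
  have rT' : rp * Theta <= q * lam ^+ 2.
    apply: le_trans rT; rewrite -[leLHS]mul1r; apply: ler_wpM2r; last exact: ltW.
    by rewrite mulr_ge0 ?(ltW rp0) ?(ltW T0).
  rewrite exprMn.
  apply: (@le_trans _ _ (lam ^+ 2 * (5 * (q * lam ^+ 2) * mm%:R))).
    apply: ler_wpM2l; first exact: sqr_ge0.
    apply: le_trans cs _; apply: le_trans QQ _.
    have -> : 5 * Theta * (rp * mm%:R) = 5 * (rp * Theta) * mm%:R by ring.
    by apply: ler_wpM2r; [exact: ltW|rewrite ler_pM2l].
  have -> : (lam ^+ 2 * (mm%:R / 2)) ^+ 2 = lam ^+ 2 * (lam ^+ 2 * (mm%:R * (mm%:R / 4))).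
    by field.
  have -> : lam ^+ 2 * (5 * (q * lam ^+ 2) * mm%:R) = lam ^+ 2 * (lam ^+ 2 *
    (mm%:R * (5 * q))).
    by ring.
  do 2 (apply: ler_wpM2l; first exact: sqr_ge0).
  by apply: ler_wpM2l; [exact: ltW|lra].
have d3 : - (lam * d) <= lam ^+ 2 * (mm%:R / 2).
  have r0 : 0 <= lam ^+ 2 * (mm%:R / 2) by rewrite mulr_ge0 ?sqr_ge0 //
    divr_ge0 ?(ltW mp).
  apply: le_trans (ler_norm _) _; rewrite normrN -(ger0_norm r0).
  by rewrite -ler_sqr ?nnegrE // !real_normK ?num_real.
have key2 : lam * (lam * mm%:R) <= lam * (- d + zeta * mm%:R + L * N (x - x0)).
  by rewrite ler_pM2l.
have zm : lam * (zeta * mm%:R) <= lam ^+ 2 * (mm%:R / 4).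
  have : zeta * mm%:R <= lam / 4 * mm%:R by apply: ler_wpM2r => //; exact: ltW.
  by rewrite -(ler_pM2l l0); lra.
have l2 : 0 < lam ^+ 2 by rewrite exprn_gt0.
(* Of lam^2 mm the cross term takes half and the noise a quarter; the rest gives mm <= 12 q, against
   mm > 20 q. *)
have : lam ^+ 2 * (mm%:R / 4) <= lam ^+ 2 * (3 * q) by lra.
by rewrite ler_pM2l //; lra.
Qed.

Lemma sparse_sub x y : Kof B e x <= kt -> Kof B e y <= kt ->
  N (x - y) ^+ 2 <= 2 * kt * norm2 B (x - y) ^+ 2.
Proof.
move=> Kx Ky; apply: le_trans (rank_sub_le hB hN hext hdec x y) _.
by apply: ler_wpM2r; [exact: sqr_ge0|lra].
Qed.

(** * Rank control and growth below the initial level *)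

Variables xinit xstar : 'cV[R]_n.
Hypotheses (hinit : om xinit <= delta * lam) (hstar : argmin Phi xstar).
Local Notation pr := (prox B N A b lam).

(** Stated for any p satisfying the inclusion, with L = 0 allowed, so that it also covers [xstar] (y
    = p = xstar). *)
Lemma level_prox_rank y p L : Phi y <= Phi xinit -> 0 <= L <= ginc * rp ->
  subdiff B N p (- lam^-1 *: (gr y + L *: (p - y))) -> Kof B e p <= kt.
Proof.
move=> yi hL hp; have gap := init_gap hinit.
have [|h1 h2] := @error_bounds y; first by lra.
exact: (prox_rank_le h1 h2 hL hp).
Qed.

Lemma xstar_rank : Kof B e xstar <= kt.
Proof.
have [rm0 rp0 _ _] := rho_facts; have gi := hginc.
apply: (@level_prox_rank xstar xstar 0); first exact: hstar.
  by rewrite lexx /= mulr_ge0 //; lra.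
rewrite scale0r addr0; apply: (argmin_subdiff hB hN) => //; exact: lam_gt0.
Qed.

Lemma phi_growth x : 2^-1 * Q (x - xstar) <= Phi x - Phi xstar.
Proof.
have l0 := lam_gt0; have := argmin_subdiff hB hN l0 hstar x.
rewrite innerZl -(ler_pM2l l0) mulrDr mulrA mulrN mulfV ?gt_eqF //.
by rewrite /phi (fls_expand A b hB xstar x); lra.
Qed.

Lemma phi_growth_rank x : Kof B e x <= kt ->
  rm * norm2 B (x - xstar) ^+ 2 <= 2 * (Phi x - Phi xstar).
Proof.
move=> Kx; have := rho_minusP A hB two_kt_ge1 (sparse_sub Kx xstar_rank).
by have := phi_growth x; lra.
Qed.

(** * One iteration of the method *)

Section Step.
Variables (y : 'cV[R]_n) (L M : R).
Hypotheses (Ky : Kof B e y <= kt) (yinit : Phi y <= Phi xinit)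
  (hL : 0 < L <= ginc * rp) (hM : backtrack B N A b lam ginc y L M).
Local Notation p := (pr M y).

Lemma step_rank L' : 0 < L' <= ginc * rp -> Kof B e (pr L' y) <= kt.
Proof.
move=> /andP[L0 L1]; apply: (level_prox_rank yinit (L := L')); first by rewrite ltW.
exact: (prox_subdiff A b hB hN y L0 lam_gt0).
Qed.

Lemma ls_failsE L' : ls_fails B N A b lam y L' <->
  L' * norm2 B (pr L' y - y) ^+ 2 < Q (pr L' y - y).
Proof. by rewrite /ls_fails (phi_mmodel N A b hB lam L' y (pr L' y)); split; lra. Qed.

(** The upper bound on L' keeps the trial point at rank at most kt; its difference with y is then
    governed by rp, and rp <= L' makes the model an upper bound. *)
Lemma ls_succeeds L' : rp <= L' <= ginc * rp -> ~ ls_fails B N A b lam y L'.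
Proof.
move=> /andP[L1 L2]; have [_ rp0 _ _] := rho_facts.
have KL : Kof B e (pr L' y) <= kt by apply: step_rank; rewrite L2 andbT; lra.
move=> /ls_failsE; apply/negP; rewrite -leNgt.
apply: le_trans (rho_plusP A hB (sparse_sub KL Ky)) _.
by apply: ler_wpM2r => //; exact: sqr_ge0.
Qed.

(** A rejected trial value is below rp, so the next is at most ginc * rp; the induction supplies the
    upper bound that [ls_succeeds] needs. *)
Lemma step_bounds : 0 < M <= ginc * rp.
Proof.
have [j [-> _ hj]] := hM; have /andP[L0 L1] := hL; have gi := hginc.
have pos i : 0 < ginc ^+ i * L by rewrite mulr_gt0 // exprn_gt0 //; lra.
rewrite pos /=.
suff H i : (i <= j)%N -> ginc ^+ i * L <= ginc * rp by exact: H.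
elim: i => [_|i IH ij]; first by rewrite mul1r.
have {}IH := IH (ltnW ij); rewrite exprS -mulrA ler_pM2l; last by lra.
rewrite leNgt; apply/negP => lt; apply: (@ls_succeeds (ginc ^+ i * L)); last exact: hj.
by rewrite (ltW lt).
Qed.

Lemma step_ls : Q (p - y) <= M * norm2 B (p - y) ^+ 2.
Proof. by have [j [_ hs _]] := hM; rewrite leNgt; apply/negP => /ls_failsE. Qed.

Lemma step_upper x : Phi p <= mmodel B N A b lam M y x.
Proof.
have /andP[M0 _] := step_bounds.
apply: le_trans (prox_argmin A b hB hN y M0 (ltW lam_gt0) x).
by have := step_ls; rewrite (phi_mmodel N A b hB lam M y p); lra.
Qed.

Lemma step_descent : Phi p + M / 2 * norm2 B (p - y) ^+ 2 <= Phi y.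
Proof.
have /andP[M0 _] := step_bounds.
have := prox_growth A b hB hN y y M0 lam_gt0; rewrite (mmodel_diag N A b hB).
rewrite -(norm2N hB (y - p)) opprB => h.
by have := step_ls; rewrite (phi_mmodel N A b hB lam M y p); lra.
Qed.

(** With G the gap at y, the model is tested on the segment to xstar. By restricted growth its value
    exceeds Phi xstar by at most G - t G + t^2 (ginc rp / rm) G, which is least at t = rm / (2 ginc
    rp), giving the factor 1 - t / 2. *)
Lemma step_rate :
  Phi p - Phi xstar <= (1 - 1 / (4 * ginc * (rp / rm))) * (Phi y - Phi xstar).
Proof.
have /andP[M0 M1] := step_bounds; have [rm0 rp0 _ _] := rho_facts; have gi := hginc.
have rmp := rho_minus_le_plus A hB hN hext two_kt_ge1.
have gr0 : 0 < ginc * rp by rewrite mulr_gt0 //; lra.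
pose t := rm / (2 * (ginc * rp)).
have t0 : 0 < t by rewrite divr_gt0 // mulr_gt0.
have t1 : t <= 1.
  have rg : rp <= 2 * (ginc * rp).
    have : 0 <= (2 * ginc - 1) * rp by apply: mulr_ge0; [lra|exact: ltW].
    lra.
  have g20 : 0 < 2 * (ginc * rp) by lra.
  by rewrite /t ler_pdivrMr // mul1r; exact: le_trans rmp rg.
have tE : t * (ginc * rp) = rm / 2 by rewrite /t; field; rewrite !gt_eqF //; lra.
have -> : 1 - 1 / (4 * ginc * (rp / rm)) = 1 - t / 2.
  by rewrite /t; field; rewrite !gt_eqF //; lra.
clearbody t.
have E : y + t *: (xstar - y) - y = t *: (xstar - y) by rewrite addrC addKr.
have := step_upper (y + t *: (xstar - y)).
have -> : mmodel B N A b lam M y (y + t *: (xstar - y)) =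
    Phi (y + t *: (xstar - y)) - 2^-1 * (t ^+ 2 * Q (xstar - y)) +
    2^-1 * (M * (t ^+ 2 * norm2 B (xstar - y) ^+ 2)).
  rewrite (phi_mmodel N A b hB lam M y (y + _)) E enorm_mulZ norm2Z // exprMn.
  by rewrite real_normK ?num_real //; lra.
have D0 : 0 <= Phi y - Phi xstar by rewrite subr_ge0; exact: hstar.
have d2 := phi_growth_rank Ky; rewrite -(norm2N hB) opprB in d2.
set s := norm2 B (xstar - y) ^+ 2 in d2 *.
have s0 : 0 <= s by exact: sqr_ge0.
have q0 : 0 <= Q (xstar - y) by exact: sqr_ge0.
have tt : 0 < t <= 1 by rewrite t0.
have cv := convex_step hN xstar y tt.
have {}cv : lam * N (y + t *: (xstar - y)) <= lam * (N y + t * (N xstar - N y)).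
  by rewrite ler_pM2l // lam_gt0.
have PhiE : Phi (y + t *: (xstar - y)) <= Phi y - t * (Phi y - Phi xstar).
  rewrite /phi (fls_expand A b hB y (y + _)) E innerZr // enorm_mulZ.
  rewrite (fls_expand A b hB y xstar).
  have : t * (t * Q (xstar - y)) <= t * (1 * Q (xstar - y)).
    by rewrite ler_pM2l //; exact: ler_wpM2r.
  lra.
have Ms : M * (t ^+ 2 * s) <= t * (Phi y - Phi xstar).
  have h1 : t * (M * (t * s)) <= t * (ginc * rp * (t * s)).
    by rewrite ler_pM2l //; apply: ler_wpM2r => //; rewrite mulr_ge0 // ltW.
  have h2 : t * (ginc * rp * (t * s)) = t * (rm / 2 * s) by rewrite -tE; ring.
  have h3 : t * (rm / 2 * s) <= t * (Phi y - Phi xstar) by rewrite ler_pM2l //; lra.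
  lra.
have : 0 <= t ^+ 2 * Q (xstar - y) by rewrite mulr_ge0 // sqr_ge0.
lra.
Qed.

(** The prox subgradient leaves the residual [adj B A *m (A *m d) - M *: d] with d = p - y, and its
    dual norm is tested on atoms, which meet the sparsity level 1. Descent gives M |d| <= S, and rm
    <= M when d is nonzero, so |d| <= S / rm. *)
Lemma step_omega : om p <=
  (1 + Num.sqrt (rho_plus B N A 1 * rp) / rm) *
  Num.sqrt (2 * ginc * rp * (Phi y - Phi xstar)).
Proof.
have /andP[M0 M1] := step_bounds; have [rm0 rp0 _ _] := rho_facts; have gi := hginc.
have gr0 : 0 < ginc * rp by rewrite mulr_gt0 //; lra.
have l0 := lam_gt0.
apply: le_trans (omega_le A b hB hN hext lam (prox_subdiff A b hB hN y M0 l0)) _.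
have Kp := step_rank step_bounds.
have Qd := rho_plusP A hB (sparse_sub Kp Ky).
have Qm := rho_minusP A hB two_kt_ge1 (sparse_sub Kp Ky).
have ls := step_ls; have desc := step_descent; have ps := hstar p.
have -> : lam *: (- lam^-1 *: (gr y + M *: (p - y))) + gr p =
    adj B A *m (A *m (p - y)) - M *: (p - y).
  rewrite -(grad_sub B A b y p) scalerA mulrN mulfV ?gt_eqF // scaleN1r opprD.
  by rewrite addrC addrA.
set d := p - y in Qd Qm ls desc *.
have nd := norm2_ge0 B d.
set r1 := Num.sqrt (rho_plus B N A 1 * _); set S := Num.sqrt _.
have S0 : 0 <= S by exact: sqrtr_ge0.
have r10 : 0 <= r1 by exact: sqrtr_ge0.
have D0 : 0 <= Phi y - Phi xstar by rewrite subr_ge0; exact: hstar.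
have MS : M * norm2 B d <= S.
  rewrite -ler_sqr ?nnegrE ?mulr_ge0 ?(ltW M0) // sqr_sqrtr; last first.
    by rewrite mulr_ge0 // -mulrA mulr_ge0 ?(ltW gr0).
  have h1 : M * (M * norm2 B d ^+ 2) <= ginc * rp * (M * norm2 B d ^+ 2).
    by apply: ler_wpM2r => //; rewrite mulr_ge0 ?sqr_ge0 // ltW.
  have h2 : ginc * rp * (M * norm2 B d ^+ 2) <= ginc * rp * (2 * (Phi y - Phi xstar)).
    by rewrite ler_pM2l //; lra.
  rewrite exprMn; lra.
have rS : norm2 B d <= S / rm.
  rewrite ler_pdivlMr // mulrC; have [d0|d0] := eqVneq (norm2 B d) 0.
    by rewrite d0 mulr0.
  have dp : 0 < norm2 B d ^+ 2 by rewrite exprn_gt0 // lt_neqAle eq_sym d0.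
  have : rm <= M by rewrite -(ler_pM2r dp); lra.
  by move=> rM; apply: le_trans MS; exact: ler_wpM2r.
apply: (@le_trans _ _ (r1 * norm2 B d + M * norm2 B d)); last first.
  have : r1 * norm2 B d <= r1 * (S / rm) by exact: ler_wpM2l.
  lra.
apply: (dual_norm_le hB hN hext) => a ata.
rewrite innerDl innerNl innerZl (inner_adj _ hB).
have aa : norm2 B a = 1 by rewrite /norm2 ata.2 sqrtr1.
have ia : - (M * ip d a) <= M * norm2 B d.
  have := normr_inner_le hB d a; rewrite aa mulr1 ler_norml => /andP[h _].
  have : M * - norm2 B d <= M * ip d a by rewrite ler_pM2l.
  lra.
have da : dot (A *m d) (A *m a) <= r1 * norm2 B d.
  apply: le_trans (inner_le (sym_posdef1 R m) _ _) _.
  rewrite -ler_sqr ?nnegrE ?mulr_ge0 ?norm2_ge0 // !exprMn.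
  have r1E : r1 ^+ 2 = rho_plus B N A 1 * rp.
    by apply: sqr_sqrtr; apply: mulr_ge0; [exact: rho_plus_ge0|exact: ltW].
  rewrite r1E.
  have Qa := rho_plusP A hB (atom_rho hB hN hext (lexx 1) ata).
  rewrite aa expr1n mulr1 in Qa.
  have -> : rho_plus B N A 1 * rp * norm2 B d ^+ 2 = (rp * norm2 B d ^+ 2) *
    rho_plus B N A 1.
    by ring.
  by apply: ler_pM => //; exact: sqr_ge0.
lra.
Qed.

End Step.
End Recovery.

Theorem theorem3 (R : realType) (m n : nat) (B : 'M[R]_n)
  (N : 'cV[R]_n -> R) (T : 'cV[R]_n -> {vspace 'cV[R]_n})
  (e : 'cV[R]_n -> 'cV[R]_n) (A : 'M[R]_(m, n))
  (x0 : 'cV[R]_n) (z : 'cV[R]_m)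
  (ginc gdec ltgt Lmin r delta lam L0 eps : R)
  (xinit xstar : 'cV[R]_n) (x : nat -> 'cV[R]_n) (L M : nat -> R)
  (hB : sym_posdef B)
  (hN : is_norm N)
  (hext : forall a, extreme_point [set y | N y <= 1] a -> norm2 B a = 1)
  (hdec : decomposable B N T e)
  (hx0 : x0 != 0)
  (hginc : 1 < ginc) (hgdec : 1 <= gdec) (hltgt : 0 < ltgt) (hLmin : 0 < Lmin)
  (hr : 1 < r) (hdelta : 0 < delta <= 1 / 4) :
  let b := A *m x0 + z in
  let K := Kof B e in
  let k0 := K x0 in
  let c := cconst B N (T x0) k0 in
  let gamma := gamma_of B N A z ltgt delta in
  let kt := 36 * r * c * k0 * (1 + gamma) * ginc in
  let rp := rho_plus B N A in
  let rm := rho_minus B N A in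
  let kappa := rp (2 * kt) / rm (2 * kt) in
  let Phi := phi N A b lam in
  let om := omega B N A b lam in
  assumptionA B N A z k0 c ginc ltgt r delta ->
  argmin Phi xstar ->
  prox_grad_run B N A b lam ginc gdec xinit L0 Lmin eps x L M ->
  Lmin <= ginc * rp (2 * kt) ->
  0 < L0 <= ginc * rp (2 * kt) ->
  ltgt <= lam ->
  K xinit <= kt ->
  om xinit <= delta * lam ->
  (forall t : nat, reached B N A b eps x M t ->
     K (x t) <= kt /\
     Phi (x t) - Phi xstar <=
       (1 - 1 / (4 * ginc * kappa)) ^+ t * (Phi xinit - Phi xstar)) /\
  (forall t : nat, (1 <= t)%N -> reached B N A b eps x M t ->
     om (x t) <=
       (1 + Num.sqrt (rp 1 * rp (2 * kt)) / rm (2 * kt)) *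
       Num.sqrt (2 * ginc * rp (2 * kt) * (Phi (x t.-1) - Phi xstar))).

Proof.
move=> b K k0 c gamma kt rp rm kappa Phi om hA hstar [x_0 L_0 hrun] hLmin' hL0
  hlam hK hom.
have [rm0 rp0 _ _] := rho_facts hB hN hext hdec hx0 hginc hltgt hr hdelta hlam hA.
rewrite -/c -/gamma -/kt -/(rp (2 * kt)) -/(rm (2 * kt)) in rm0 rp0.
have gr0 : 0 < ginc * rp (2 * kt) by rewrite mulr_gt0 //; lra.
have rmp : rm (2 * kt) <= rp (2 * kt).
  apply: (rho_minus_le_plus A hB hN hext).
  exact: (two_kt_ge1 hB hN hext hdec hx0 hginc hltgt hr hdelta hlam hA).
(* Nonnegativity of the factor allows the one-step rates to be multiplied. *)
have q0 : 0 <= 1 - 1 / (4 * ginc * kappa).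
  have kap1 : 1 <= kappa by rewrite ler_pdivlMr // mul1r.
  have : 1 <= ginc * kappa by rewrite mulr_ege1 // ltW.
  move: (kappa) => k gk; have gk0 : 0 < 4 * ginc * k by lra.
  by rewrite subr_ge0 ler_pdivrMr // mul1r; lra.
have reachedS t : reached B N A b eps x M t.+1 -> reached B N A b eps x M t.
  by move=> h s /andP[s0 st]; apply: h; rewrite s0 ltnW.
(* The level bound feeds the rank estimate of the next step. The bound on L passes on because gdec
   >= 1 and Lmin is itself at most ginc * rp. *)
have inv t : reached B N A b eps x M t ->
    [/\ K (x t) <= kt, Phi (x t) <= Phi xinit, 0 < L t <= ginc * rp (2 * kt) &
      Phi (x t) - Phi xstar <=
        (1 - 1 / (4 * ginc * kappa)) ^+ t * (Phi xinit - Phi xstar)].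
  elim: t => [_|t IH ht]; first by rewrite x_0 L_0 expr0 mul1r.
  have [Kt Pt Lt Rt] := IH (reachedS t ht).
  have [hbt xE LE] := hrun t ht.
  have := step_bounds hB hN hext hdec hx0 hginc hltgt hr hdelta hlam hA hom Kt Pt Lt hbt.
  rewrite -/c -/gamma -/kt -/(rp (2 * kt)) => /andP[M0 M1].
  have Kp := step_rank hB hN hext hdec hx0 hginc hltgt hr hdelta hlam hA hom Pt
    (L' := M t.+1).
  have desc := step_descent hB hN hext hdec hx0 hginc hltgt hr hdelta hlam hA
    hom Kt Pt Lt hbt.
  have rate := step_rate hB hN hext hdec hx0 hginc hltgt hr hdelta hlam hA hom
    hstar Kt Pt Lt hbt.
  rewrite -xE in Kp desc rate; split.
  - by apply: Kp; rewrite M0.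
  - apply: le_trans Pt; apply: le_trans desc; rewrite lerDl.
    by rewrite mulr_ge0 ?sqr_ge0 // divr_ge0 // ltW.
  - rewrite LE lt_max hLmin ge_max hLmin' /=; apply: le_trans M1.
    rewrite ler_pdivrMr; last by lra.
    by rewrite -[leLHS]mulr1; apply: ler_wpM2l => //; exact: ltW.
  - apply: le_trans rate _; rewrite exprS -[leRHS]mulrA; exact: (ler_wpM2l q0 Rt).
split=> [t /inv[]//|[//|t] _ ht].
have [Kt Pt Lt _] := inv t (reachedS t ht); have [hbt -> _] := hrun t ht.
exact: (step_omega hB hN hext hdec hx0 hginc hltgt hr hdelta hlam hA hom hstar
  Kt Pt Lt hbt).
Qed.
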